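(* Let $a(n)$ be the arithmetic function with $a(1)=0$ and $a(n)=\lambda(n)$ for $n\ge2$, where $\lambda$ is the Liouville function. For each $n\ge2$ let $\xi(n)\in(1/2,1)$ be the number satisfying $n^{-1}-n^{-1/2}=-\frac12\log(n)\,n^{-\xi(n)}$, and for $x\ge1$ let $$L_x(\xi)=\frac12\sum_{n\le x}\frac{a(n)\log(n)}{n^{\xi(n)}}$$ (the $n=1$ term is zero). If there exists $r>0$ such that $L_x(\xi)\le 1-r$ for all sufficiently large $x$, then $\frac{\zeta(2s)}{\zeta(s)}$ is analytic in the half-plane $\mathrm{Re}(s)>1/2$.
   Context: $\zeta(s)$ is the Riemann zeta function. The Liouville function $\lambda(n)$ is the completely multiplicative function with $\lambda(1)=1$ and $\lambda(p)=-1$ for every prime $p$. The sequence $\xi$ is the one obtained from the mean value theorem applied to $n^{-\gamma}$ on $[1/2,1]$, so that $\sum_{n\le x}a(n)n^{-1/2}=\sum_{n\le x}a(n)n^{-1}+L_x(\xi)$ for all $x\ge1$. *)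

(* Defs.v *)
From Stdlib Require Import Reals ZArith Znumtheory.
From Coquelicot Require Export Coquelicot.
Open Scope R_scope.

(* n^{-s} = exp(-s log n) for a positive integer n and complex s. *)
Definition cpow_neg (n : nat) (s : C) : C :=
  let t := - ln (INR n) in
  (exp (t * Re s) * cos (t * Im s), exp (t * Re s) * sin (t * Im s)).

Definition is_liouville (lam : nat -> R) : Prop :=
  lam 1%nat = 1 /\
  (forall m n : nat, (1 <= m)%nat -> (1 <= n)%nat -> lam (m * n)%nat = lam m * lam n) /\
  (forall p : nat, prime (Z.of_nat p) -> lam p = -1).

Definition a_fun (lam : nat -> R) (n : nat) : R :=
  if (n <=? 1)%nat then 0 else lam n.

Fixpoint S_part (lam xi : nat -> R) (N : nat) : R :=
  match N with
  | O => 0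
  | S k => S_part lam xi k
           + a_fun lam (S k) * ln (INR (S k)) / Rpower (INR (S k)) (xi (S k))
  end.

Definition L_x (lam xi : nat -> R) (x : R) : R :=
  / 2 * S_part lam xi (Z.to_nat (Int_part x)).

Definition holomorphic_on (D : C -> Prop) (F : C -> C) : Prop :=
  forall s, D s -> exists l : C, @is_derive C_AbsRing C_NormedModule F s l.

(* Main.v *)
(* Write [T(N)] for the sum of [lam(n) n^(-1/2)] over [n <= N]. The hypothesis bounds [T(N)] minus
   the sum of [lam(n)/n] from above, and the latter sum is bounded by [2] because
   [sum_(d|n) lam(d)] is the indicator of squares; so [T <= B] for some [B], and no form of the
   prime number theorem is needed. By Abel summation, [D(s) = zeta(2s)/zeta(s)] satisfies
   [B - D(1/2 + w) = w * sum_N (B - T(N)) c_N(w)] with [c_N(w) = (N^(-w) - (N+1)^(-w)) / w],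
   whose derivatives in [w] alternate in sign. As the alternating zeta function
   [eta(s) = (1 - 2^(1-s)) zeta(s)] is positive for [s > 0], the left side equals, for real [w],
   a quotient [K/Q] of functions analytic on [w > 0], and Landau's theorem gives convergence of
   the nonnegative series for all [w > 0]. It is proved with real power series only: the Taylor
   coefficients of [K/Q] are geometrically bounded uniformly on compact subsets of [w > 0], so each
   step extends convergence by a fixed length. The complex series then converges, with quadratic
   remainder estimates, on [Re w > 0]. *)

Require Import Defs.
From Stdlib Require Import Reals ZArith Znumtheory Lia Lra.
From Coquelicot Require Import Coquelicot.
Open Scope R_scope.

(** * Real series *)

(* Equations obtained from [sum_n] and [is_series] live in a structure carrier convertible to [R],
   where [ring] finds no ring structure. *)
Ltac rring := match goal with |- @eq _ ?x ?y => change (@eq R x y) end; ring.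

(** Division by [w] creates the positivity: [c_N(w)] is the integral of [exp (- w t)] over
    [log N <= t <= log (N+1)], so its derivatives alternate, whereas the undivided difference
    [N^(-w) - (N+1)^(-w)] is increasing near [w = 0]. The pole of [zeta] at [s = 1] corresponds to
    [w = 1/2], inside the range to be crossed; this is why [eta] stands in the denominator, and [K]
    is built from [eta], [2^(-w)] and [zeta(1 + 2 w)], all regular for [w > 0]. Complex zeros of
    [zeta] close to the real segment cannot be excluded in advance, so the coefficient bound for
    [K/Q] uses only the coefficient bounds of [K] and [Q] and a lower bound for [Q] at the real
    centre. Convergence at real [w] then suffices for the half-plane, because
    [|N^(-w) - (N+1)^(-w)|] is at most [|w|] times the integral of [exp (- t Re w)] over the same
    interval. *)

Lemma sum_n_S (a : nat -> R) n : sum_n a (S n) = sum_n a n + a (S n).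
Proof. now rewrite sum_Sn. Qed.

Lemma sum_n_nonneg (a : nat -> R) n : (forall i, 0 <= a i) -> 0 <= sum_n a n.
Proof.
  intros H; induction n as [|n IH]; [rewrite sum_O; apply H|].
  rewrite sum_n_S; specialize (H (S n)); lra.
Qed.

Lemma sum_n_le_compat (a b : nat -> R) n :
  (forall i, (i <= n)%nat -> a i <= b i) -> sum_n a n <= sum_n b n.
Proof.
  intros H; induction n as [|n IH]; [rewrite !sum_O; apply H; lia|].
  rewrite !sum_n_S; apply Rplus_le_compat; [apply IH; intros; apply H; lia|apply H; lia].
Qed.

Lemma series_plus (a b : nat -> R) (la lb : R) :
  is_series a la -> is_series b lb -> is_series (fun n => a n + b n) (la + lb).
Proof. exact (is_series_plus a b la lb). Qed.

Lemma series_minus (a b : nat -> R) (la lb : R) :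
  is_series a la -> is_series b lb -> is_series (fun n => a n - b n) (la - lb).
Proof. exact (is_series_minus a b la lb). Qed.

Lemma series_scal (c : R) (a : nat -> R) l :
  is_series a l -> is_series (fun n => c * a n) (c * l).
Proof. exact (is_series_scal c a l). Qed.

Lemma series_unique (a : nat -> R) (l l' : R) : is_series a l -> is_series a l' -> l = l'.
Proof. intros H H'; now rewrite <- (is_series_unique _ _ H), <- (is_series_unique _ _ H'). Qed.

Lemma series_eq (a b : nat -> R) (l l' : R) :
  is_series a l -> (forall n, a n = b n) -> l = l' -> is_series b l'.
Proof. intros H E <-; exact (is_series_ext _ _ _ E H). Qed.

Lemma sum_n_le_series (a : nat -> R) l n :
  (forall i, 0 <= a i) -> is_series a l -> sum_n a n <= l.
Proof.
  intros P H. apply (is_lim_seq_incr_compare (sum_n a) l); [exact H|].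
  intros k; rewrite sum_n_S; specialize (P (S k)); lra.
Qed.

Lemma series_nonneg (a : nat -> R) l : (forall i, 0 <= a i) -> is_series a l -> 0 <= l.
Proof.
  intros P H; apply Rle_trans with (sum_n a 0); [now apply sum_n_nonneg|now apply sum_n_le_series].
Qed.

Lemma term_le_series (a : nat -> R) l n :
  (forall i, 0 <= a i) -> is_series a l -> a n <= l.
Proof.
  intros P H; apply Rle_trans with (sum_n a n); [|now apply sum_n_le_series].
  destruct n; [rewrite sum_O; lra|].
  rewrite sum_n_S; pose proof (sum_n_nonneg a n P); lra.
Qed.

Lemma series_bounded (a : nat -> R) M :
  (forall i, 0 <= a i) -> (forall n, sum_n a n <= M) -> exists l, is_series a l /\ l <= M.
Proof.
  intros P B.
  destruct (ex_finite_lim_seq_incr (sum_n a) M) as [l Hl]; [|exact B|].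
  { intros n; rewrite sum_n_S; specialize (P (S n)); lra. }
  exists l; split; [exact Hl|].
  apply (is_lim_seq_le (sum_n a) (fun _ => M) l M B Hl), is_lim_seq_const.
Qed.

Lemma series_le (a b : nat -> R) (la lb : R) :
  (forall n, a n <= b n) -> is_series a la -> is_series b lb -> la <= lb.
Proof.
  intros H Ha Hb. apply (is_lim_seq_le (sum_n a) (sum_n b) la lb); [|exact Ha|exact Hb].
  intros n; apply sum_n_le_compat; intros; apply H.
Qed.

Lemma ex_series_dom (a b : nat -> R) :
  (forall n, Rabs (a n) <= b n) -> ex_series b -> ex_series a.
Proof. intros H Hb; exact (ex_series_le a b H Hb). Qed.

Lemma Rabs_series_le (a b : nat -> R) la lb :
  (forall n, Rabs (a n) <= b n) -> is_series a la -> is_series b lb -> Rabs la <= lb.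
Proof.
  intros H Ha Hb; apply Rabs_le; split.
  - replace (- lb) with ((-1) * lb) by rring.
    apply (series_le (fun n => (-1) * b n) a); [|now apply series_scal|exact Ha].
    intros n; specialize (H n); apply Rabs_le_between in H; lra.
  - apply (series_le a b); [|exact Ha|exact Hb].
    intros n; specialize (H n); apply Rabs_le_between in H; lra.
Qed.

(** * Interchange of summation in double series *)

Lemma sum_n_of_series (a : nat -> nat -> R) (r : nat -> R) n :
  (forall i, is_series (a i) (r i)) ->
  is_series (fun j => sum_n (fun i => a i j) n) (sum_n r n).
Proof.
  intros H; induction n as [|n IH].
  - rewrite sum_O; apply (series_eq _ _ _ _ (H 0%nat)); [|reflexivity].
    intros; now rewrite sum_O.
  - rewrite sum_n_S; apply (series_eq _ _ _ _ (series_plus _ _ _ _ IH (H (S n)))); [|reflexivity].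
    intros; now rewrite sum_n_S.
Qed.

Lemma tonelli_le (a : nat -> nat -> R) (r : nat -> R) l :
  (forall i j, 0 <= a i j) -> (forall i, is_series (a i) (r i)) -> is_series r l ->
  exists (c : nat -> R) (l' : R), (forall j, is_series (fun i => a i j) (c j)) /\ is_series c l' /\ l' <= l.
Proof.
  intros P Hr Hl.
  assert (Hc : forall j, is_series (fun i => a i j) (Series (fun i => a i j))).
  { intros j; apply Series_correct, (ex_series_dom _ r); [|now exists l].
    intros i; rewrite Rabs_pos_eq by apply P. now apply term_le_series. }
  exists (fun j => Series (fun i => a i j)).
  destruct (series_bounded (fun j => Series (fun i => a i j)) l) as [l' [H1 H2]].
  - intros j; apply (series_nonneg (fun i => a i j)); auto.
  - intros n; apply (series_le (fun i => sum_n (a i) n) r); [| |exact Hl].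
    + intros i; now apply sum_n_le_series.
    + exact (sum_n_of_series (fun j i => a i j) _ n Hc).
  - exists l'; auto.
Qed.

(** The inequality [tonelli_le], used for the array and for its transpose, gives [l'' <= l' <= l];
    as [l''] is again the sum of the row sums, it equals [l]. *)
Lemma tonelli (a : nat -> nat -> R) (r : nat -> R) l :
  (forall i j, 0 <= a i j) -> (forall i, is_series (a i) (r i)) -> is_series r l ->
  exists c : nat -> R, (forall j, is_series (fun i => a i j) (c j)) /\ is_series c l.
Proof.
  intros P Hr Hl.
  destruct (tonelli_le a r l P Hr Hl) as [c [l' [Hc [Hl' L]]]].
  destruct (tonelli_le (fun j i => a i j) c l') as [r' [l'' [Hr' [Hl'' L']]]]; auto.
  exists c; split; auto.
  replace l with l'; auto. apply Rle_antisym; auto.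
  replace l with l''; auto.
  apply (series_unique r); auto.
  apply (series_eq _ _ _ _ Hl''); auto.
  intros n; apply (series_unique (a n)); auto.
Qed.

(** Reduction to nonnegative arrays: [e] and [e + a] are nonnegative with summable row sums, and [a]
    is their difference. *)
Lemma fubini (a e : nat -> nat -> R) (r R0 : nat -> R) :
  (forall i j, Rabs (a i j) <= e i j) -> (forall i, is_series (e i) (R0 i)) -> ex_series R0 ->
  (forall i, is_series (a i) (r i)) ->
  exists (c : nat -> R) (l : R), (forall j, is_series (fun i => a i j) (c j)) /\ is_series c l /\ is_series r l.
Proof.
  intros B He [L HL] Hr.
  assert (P : forall i j, 0 <= e i j) by (intros; eapply Rle_trans; [apply Rabs_pos|apply B]).
  assert (Hr2 : ex_series (fun i => R0 i + r i)).
  { apply (ex_series_dom _ (fun i => 2 * R0 i)); [|exists (2 * L); now apply series_scal].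
    intros i. assert (Rabs (r i) <= R0 i) by (apply (Rabs_series_le (a i) (e i)); auto).
    assert (0 <= R0 i) by (apply (series_nonneg (e i)); auto).
    apply Rabs_le_between in H; apply Rabs_le; lra. }
  destruct Hr2 as [L2 HL2].
  destruct (tonelli e R0 L P He HL) as [c1 [Hc1 S1]].
  destruct (tonelli (fun i j => e i j + a i j) (fun i => R0 i + r i) L2) as [c2 [Hc2 S2]]; auto.
  { intros i j; specialize (B i j); apply Rabs_le_between in B; lra. }
  { intros i; now apply series_plus. }
  exists (fun j => c2 j - c1 j), (L2 - L); split; [|split].
  - intros j; apply (series_eq _ _ _ _ (series_minus _ _ _ _ (Hc2 j) (Hc1 j))); [intros; simpl; ring|reflexivity].
  - now apply series_minus.
  - apply (series_eq _ _ _ _ (series_minus _ _ _ _ HL2 HL)); [intros; simpl; ring|reflexivity].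
Qed.

(** Every partial sum of [b] is zero or a partial sum of [v], cut at the last [k] with [phi k <= n].
    It serves for the multiples of a fixed integer and for the squares. *)
Lemma series_sparse (v b : nat -> R) (phi : nat -> nat) l :
  (forall k, (phi k < phi (S k))%nat) -> (forall k, b (phi k) = v k) ->
  (forall n, (forall k, phi k <> n) -> b n = 0) ->
  is_series v l -> is_series b l.
Proof.
  intros M Hv H0 Hs.
  assert (M' : forall j k, (j < k)%nat -> (phi j < phi k)%nat).
  { intros j k; induction k as [|k IH]; [lia|].
    intros; destruct (Nat.eq_dec j k) as [->|]; [apply M|].
    apply Nat.lt_trans with (phi k); [apply IH; lia|apply M]. }
  assert (Z : forall n, (n < phi 0%nat)%nat -> sum_n b n = 0).
  { induction n as [|n IH]; intros.
    - rewrite sum_O; apply H0; intros k E.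
      destruct k; [lia|]. pose proof (M' 0%nat (S k)); lia.
    - rewrite sum_n_S, IH by lia. rewrite H0; [rring|].
      intros k E. destruct k; [lia|]. pose proof (M' 0%nat (S k)); lia. }
  assert (Q : forall n, (phi 0%nat <= n)%nat ->
     exists k, (phi k <= n < phi (S k))%nat /\ sum_n b n = sum_n v k).
  { induction n as [|n IH]; intros Hn.
    - exists 0%nat; split; [specialize (M 0%nat); lia|].
      rewrite !sum_O, <- Hv; f_equal; lia.
    - destruct (Nat.eq_dec (phi 0%nat) (S n)) as [E|E].
      + exists 0%nat; split; [specialize (M 0%nat); lia|].
        rewrite sum_n_S, sum_O, Z, <- Hv, E by lia; rring.
      + destruct IH as [k [Hk E2]]; [lia|].
        destruct (Nat.eq_dec (phi (S k)) (S n)) as [F|F].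
        * exists (S k); split; [specialize (M (S k)); lia|].
          rewrite !sum_n_S, E2, <- Hv, F; rring.
        * exists k; split; [lia|].
          rewrite sum_n_S, E2, H0; [rring|].
          intros j Ej. destruct (Nat.lt_trichotomy j k) as [C|[->|C]].
          -- pose proof (M' j k C); lia.
          -- lia.
          -- destruct (Nat.eq_dec j (S k)) as [->|]; [lia|].
             pose proof (M' (S k) j ltac:(lia)); lia. }
  intros P HP. destruct (Hs P HP) as [N HN].
  exists (phi N); intros n Hn.
  destruct (Q n) as [k [Hk E]].
  { destruct N; [lia|]. pose proof (M' 0%nat (S N)); lia. }
  change (P (sum_n b n)); rewrite E; apply HN. destruct (Nat.le_gt_cases N k); auto.
  destruct (Nat.eq_dec N (S k)) as [->|]; [lia|].
  pose proof (M' (S k) N); lia.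
Qed.

Lemma series_finite (b : nat -> R) N :
  (forall n, (N < n)%nat -> b n = 0) -> is_series b (sum_n b N).
Proof.
  intros H P HP. exists N; intros n Hn.
  assert (E : sum_n b n = sum_n b N); [|change (P (sum_n b n)); rewrite E; exact (locally_singleton _ _ HP)].
  induction Hn as [|n Hn IH]; [reflexivity|].
  rewrite sum_n_S, IH, H by lia; rring.
Qed.

(** * Divisor sums of the Liouville function *)

Definition dvd (d n : nat) : bool := Nat.eqb (n mod d) 0.

Lemma dvdP d n : dvd d n = true <-> Nat.divide d n.
Proof. unfold dvd; rewrite Nat.eqb_eq; apply Nat.Lcm0.mod_divide. Qed.

Lemma dvd_iff d n d' n' : (Nat.divide d n <-> Nat.divide d' n') -> dvd d n = dvd d' n'.
Proof.
  rewrite <- !dvdP; destruct (dvd d n), (dvd d' n'); auto; intros [H1 H2].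
  - symmetry; auto.
  - auto.
Qed.

Lemma dvd_false d n : ~ Nat.divide d n -> dvd d n = false.
Proof. rewrite <- dvdP; now destruct (dvd d n). Qed.

Lemma divide_Z d n : Nat.divide d n <-> (Z.of_nat d | Z.of_nat n)%Z.
Proof.
  split; intros [k Hk].
  - exists (Z.of_nat k); lia.
  - destruct (Nat.eq_dec d 0) as [->|Hd]; [exists 0%nat; lia|].
    exists (Z.to_nat k); destruct (Z.le_gt_cases 0 k); nia.
Qed.

Lemma prime_nat_gt1 p : prime (Z.of_nat p) -> (1 < p)%nat.
Proof. intros [H _]; lia. Qed.

Lemma prime_nat_mult p a b :
  prime (Z.of_nat p) -> Nat.divide p (a * b) -> Nat.divide p a \/ Nat.divide p b.
Proof. rewrite !divide_Z, Nat2Z.inj_mul; intros H; now apply prime_mult. Qed.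

Lemma exists_prime_divisor n :
  (1 < n)%nat -> exists p m, prime (Z.of_nat p) /\ n = (p * m)%nat /\ (1 <= m < n)%nat.
Proof.
  induction n as [n IH] using (well_founded_induction lt_wf); intros Hn.
  destruct (prime_dec (Z.of_nat n)) as [P|P].
  - exists n, 1%nat; split; [auto|split; lia].
  - destruct (not_prime_divide (Z.of_nat n)) as [q [Hq D]]; [lia|auto|].
    assert (D' : Nat.divide (Z.to_nat q) n) by (apply divide_Z; rewrite Z2Nat.id; auto; lia).
    destruct (IH (Z.to_nat q)) as [p [m [Pp [E _]]]]; [lia|lia|].
    destruct D' as [k Hk]. pose proof (prime_nat_gt1 p Pp).
    rewrite E in Hk; assert (n = (p * (k * m))%nat) by (rewrite Hk; ring).
    assert (1 <= k * m)%nat by (destruct (k * m)%nat; lia).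
    exists p, (k * m)%nat; split; [auto|split; nia].
Qed.

Lemma divide_prime_mul_iff p d n :
  prime (Z.of_nat p) -> ~ Nat.divide p d -> Nat.divide d (p * n) <-> Nat.divide d n.
Proof.
  intros P N; split; [|intros H; now apply Nat.divide_mul_r].
  intros [k Hk].
  destruct (prime_nat_mult p k d P) as [[j Hj]|]; [exists n; lia| |contradiction].
  exists j; pose proof (prime_nat_gt1 p P); nia.
Qed.

Definition is_square (n : nat) : bool := Nat.eqb (Nat.sqrt n * Nat.sqrt n) n.

Lemma is_squareP n : is_square n = true <-> exists k, n = (k * k)%nat.
Proof.
  unfold is_square; rewrite Nat.eqb_eq; split.
  - intros H; now exists (Nat.sqrt n).
  - intros [k ->]; now rewrite Nat.sqrt_square.
Qed.

Lemma is_square_prime_sq p m :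
  prime (Z.of_nat p) -> is_square (p * (p * m)) = is_square m.
Proof.
  intros P; pose proof (prime_nat_gt1 p P).
  destruct (is_square m) eqn:E.
  - apply is_squareP in E as [k ->]; apply is_squareP; exists (p * k)%nat; ring.
  - apply Bool.not_true_is_false; rewrite is_squareP; intros [k Hk].
    apply Bool.not_true_iff_false in E; apply E, is_squareP.
    assert (D : Nat.divide p k).
    { destruct (prime_nat_mult p k k P); auto. exists (p * m)%nat; lia. }
    destruct D as [j ->]; exists j; nia.
Qed.

Lemma is_square_prime_once p m :
  prime (Z.of_nat p) -> ~ Nat.divide p m -> is_square (p * m) = false.
Proof.
  intros P N; pose proof (prime_nat_gt1 p P).
  apply Bool.not_true_is_false; rewrite is_squareP; intros [k Hk].
  assert (D : Nat.divide p k).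
  { destruct (prime_nat_mult p k k P); auto. exists m; lia. }
  destruct D as [j ->]; apply N; exists (j * j)%nat; nia.
Qed.

Lemma liouville_abs lam : is_liouville lam -> forall n, (1 <= n)%nat -> Rabs (lam n) = 1.
Proof.
  intros [H1 [HM HP]] n; induction n as [n IH] using (well_founded_induction lt_wf); intros Hn.
  destruct (Nat.eq_dec n 1) as [->|N]; [rewrite H1; apply Rabs_R1|].
  destruct (exists_prime_divisor n) as [p [m [P [-> Hm]]]]; [lia|].
  pose proof (prime_nat_gt1 p P).
  rewrite HM, Rabs_mult, (IH m), HP by (auto; lia).
  rewrite Rabs_left by lra; ring.
Qed.

Definition div_term (lam : nat -> R) (n i : nat) : R := if dvd (S i) n then lam (S i) else 0.

(** The index [i <= n] lets the candidate [S i] run up to [n + 1], which does not divide [n] when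
    [n >= 1]. *)
Definition div_sum (lam : nat -> R) (n : nat) : R := sum_n (div_term lam n) n.

Lemma div_sum_series lam n : (1 <= n)%nat -> is_series (div_term lam n) (div_sum lam n).
Proof.
  intros Hn; apply series_finite; intros i Hi; unfold div_term.
  rewrite dvd_false; auto. intros D; apply Nat.divide_pos_le in D; lia.
Qed.

Lemma series_multiples (v b : nat -> R) d l : (1 <= d)%nat ->
  (forall k, b (d * S k - 1)%nat = v k) ->
  (forall n, ~ Nat.divide d (S n) -> b n = 0) ->
  is_series v l -> is_series b l.
Proof.
  intros Hd Hv H0; apply (series_sparse v b (fun k => d * S k - 1)%nat); auto; [nia|].
  intros n Hn; apply H0; intros [k Hk]. destruct k; [lia|]. apply (Hn k); lia.
Qed.

(* Splitting the divisors of [p * n] according to whether [p] divides them. *)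
Lemma div_sum_prime lam : is_liouville lam -> forall p n, prime (Z.of_nat p) -> (1 <= n)%nat ->
  is_series (fun i => if dvd p (S i) then 0 else div_term lam n i)
    (div_sum lam (p * n) + div_sum lam n).
Proof.
  intros [H1 [HM HP]] p n P Hn; pose proof (prime_nat_gt1 p P).
  assert (A : is_series (fun i => if dvd p (S i) then div_term lam (p * n) i else 0)
                ((-1) * div_sum lam n)).
  { apply (series_multiples (fun i => (-1) * div_term lam n i) _ p); [lia| | |].
    - intros k; replace (S (p * S k - 1)) with (p * S k)%nat by lia.
      replace (dvd p (p * S k)) with true by (symmetry; apply dvdP; exists (S k); ring).
      unfold div_term; replace (S (p * S k - 1)) with (p * S k)%nat by lia.
      replace (dvd (p * S k) (p * n)) with (dvd (S k) n).
      + rewrite HM, HP by (auto; lia). destruct (dvd (S k) n); ring.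
      + apply dvd_iff. symmetry; apply Nat.mul_divide_cancel_l; lia.
    - intros i D; now rewrite dvd_false.
    - now apply series_scal, div_sum_series. }
  apply (series_eq _ _ _ _ (series_minus _ _ _ _ (div_sum_series lam (p * n) ltac:(nia)) A));
    [|rring].
  intros i; simpl; destruct (dvd p (S i)) eqn:E; [rring|].
  rewrite Rminus_0_r; unfold div_term.
  rewrite (dvd_iff (S i) (p * n) (S i) n); auto.
  apply divide_prime_mul_iff; auto. rewrite <- dvdP, E; discriminate.
Qed.

(** Strong induction on [n = p m]. If [m = p m'], the divisors prime to [p] are the same for [m] and
    [m'], so comparing two instances of [div_sum_prime] shows that [p p m'] and [m'] have equal
    divisor sums. If [p] does not divide [m], all divisors of [m] are prime to [p], and the divisor
    sum of [p m] is [0]. *)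
Lemma div_sum_square lam : is_liouville lam -> forall n, (1 <= n)%nat ->
  div_sum lam n = if is_square n then 1 else 0.
Proof.
  intros HL n; induction n as [n IH] using (well_founded_induction lt_wf); intros Hn.
  destruct (Nat.eq_dec n 1) as [->|N].
  { unfold div_sum; rewrite sum_n_S, sum_O; unfold div_term; simpl.
    destruct HL as [-> _]; rring. }
  destruct (exists_prime_divisor n) as [p [m [P [-> Hm]]]]; [lia|].
  pose proof (prime_nat_gt1 p P).
  pose proof (div_sum_prime lam HL p m P ltac:(lia)) as S1.
  destruct (dvd p m) eqn:E.
  - apply dvdP in E as [m' ->]; rewrite (Nat.mul_comm m' p) in *.
    rewrite is_square_prime_sq, <- IH by (auto; nia).
    pose proof (div_sum_prime lam HL p m' P ltac:(lia)) as S2.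
    assert (div_sum lam (p * (p * m')) + div_sum lam (p * m') =
            div_sum lam (p * m') + div_sum lam m'); [|lra].
    apply (series_unique _ _ _ S1).
    apply (series_eq _ _ _ _ S2); [|reflexivity].
    intros i; destruct (dvd p (S i)) eqn:E; [reflexivity|]; unfold div_term.
    rewrite (dvd_iff (S i) (p * m') (S i) m'); auto.
    apply divide_prime_mul_iff; auto; rewrite <- dvdP, E; discriminate.
  - assert (E' : ~ Nat.divide p m) by (rewrite <- dvdP, E; discriminate).
    rewrite is_square_prime_once by auto.
    assert (div_sum lam (p * m) + div_sum lam m = div_sum lam m); [|lra].
    apply (series_unique _ _ _ S1).
    apply (series_eq _ _ _ _ (div_sum_series lam m ltac:(lia))); [|reflexivity].
    intros i; destruct (dvd p (S i)) eqn:F; [|reflexivity]; unfold div_term.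
    rewrite dvd_false; auto. intros D; apply E'; apply Nat.divide_trans with (S i); auto.
    now apply dvdP.
Qed.

(** [q] is the integer part of [(N + 1) / d], encoded by its two defining inequalities. *)
Lemma count_multiples d N : (1 <= d)%nat ->
  exists q : nat, sum_n (fun i => if dvd d (S i) then 1 else 0) N = INR q /\
    (q * d <= S N < S q * d)%nat.
Proof.
  intros Hd; induction N as [|N [q [E Hq]]].
  - rewrite sum_O; destruct (dvd d 1) eqn:D.
    + apply dvdP, Nat.divide_pos_le in D; [|lia]. exists 1%nat; split; [reflexivity|lia].
    + exists 0%nat; split; [reflexivity|]. split; [lia|].
      destruct (Nat.eq_dec d 1) as [->|]; [discriminate|lia].
  - rewrite sum_n_S, E; destruct (dvd d (S (S N))) eqn:D.
    + exists (S q); rewrite S_INR; split; [rring|].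
      apply dvdP in D as [k Hk]. assert (k = S q) by nia. subst k; nia.
    + exists q; split; [rring|]. split; [lia|].
      destruct (Nat.eq_dec (S (S N)) (S q * d)) as [F|]; [|lia].
      rewrite F in D. rewrite (proj2 (dvdP _ _)) in D; [discriminate|]. now exists (S q).
Qed.

(* Sum [sum_(d|n) lam d = [n is a square]] over [n <= N]: the left side is within [N]
   of [N * sum_(d <= N) lam d / d]. *)
Lemma liouville_harmonic_bound lam : is_liouville lam -> forall N,
  sum_n (fun i => lam (S i) / INR (S i)) N <= 2.
Proof.
  intros HL N.
  assert (S1 : sum_n (fun j => sum_n (fun i => div_term lam (S j) i) N) N <= INR (S N)).
  { rewrite <- (Rmult_1_r (INR (S N))).
    replace (INR (S N) * 1) with (sum_n (fun _ : nat => 1) N).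
    2:{ rewrite sum_n_const; reflexivity. }
    apply sum_n_le_compat; intros j Hj.
    replace (sum_n (fun i => div_term lam (S j) i) N) with (div_sum lam (S j)).
    { rewrite div_sum_square by (auto; lia). destruct (is_square (S j)); lra. }
    apply (series_unique (div_term lam (S j))); [apply div_sum_series; lia|].
    apply series_finite; intros i Hi; unfold div_term; rewrite dvd_false; auto.
    intros D; apply Nat.divide_pos_le in D; lia. }
  rewrite sum_n_switch in S1.
  (* With [d = i + 1] and [x = (N + 1) / d], the term [lam d * x - 1] is at most [lam d] times the
     integer part of [x], since [|lam d| = 1] and the fractional part is at most [1]. *)
  assert (S2 : sum_n (fun i => INR (S N) * (lam (S i) / INR (S i)) - 1) N <=
     sum_n (fun i => sum_n (fun j => div_term lam (S j) i) N) N).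
  { apply sum_n_le_compat; intros i Hi.
    destruct (count_multiples (S i) N ltac:(lia)) as [q [E Hq]].
    replace (sum_n (fun j => div_term lam (S j) i) N) with (lam (S i) * INR q).
    2:{ rewrite <- E. rewrite <- (sum_n_mult_l (K:=R_Ring) (lam (S i))).
        apply sum_n_ext; intros j; unfold div_term, mult; simpl.
        destruct (dvd (S i) (S j)); ring. }
    assert (A := liouville_abs lam HL (S i) ltac:(lia)).
    assert (P : 0 < INR (S i)) by (apply lt_0_INR; lia).
    assert (B1 : INR q * INR (S i) <= INR (S N)) by (rewrite <- mult_INR; apply le_INR; lia).
    assert (B2 : INR (S N) <= (INR q + 1) * INR (S i)).
    { rewrite <- S_INR, <- mult_INR; apply le_INR; lia. }
    assert (B3 : 0 <= INR (S N) / INR (S i) - INR q <= 1).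
    { replace (INR (S N) / INR (S i) - INR q) with ((INR (S N) - INR q * INR (S i)) / INR (S i)) by (field; lra).
      split; [apply Rdiv_le_0_compat; lra|].
      apply Rmult_le_reg_r with (INR (S i)); auto. unfold Rdiv; rewrite Rmult_assoc, Rinv_l by lra; lra. }
    replace (INR (S N) * (lam (S i) / INR (S i))) with (lam (S i) * (INR (S N) / INR (S i))) by (field; lra).
    assert (A2 : -1 <= lam (S i) <= 1) by (apply Rabs_le_between; lra).
    nra. }
  assert (S3 : sum_n (fun i => INR (S N) * (lam (S i) / INR (S i)) - 1) N =
     INR (S N) * sum_n (fun i => lam (S i) / INR (S i)) N - INR (S N)).
  { clear. generalize (INR (S N)) at 1 2; intros c.
    induction N as [|N IH]; [rewrite !sum_O; simpl; rring|].
    rewrite !sum_n_S, IH, (S_INR (S N)); rring. }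
  assert (P : 1 <= INR (S N)) by (rewrite S_INR; pose proof (pos_INR N); lra).
  assert (S4 : INR (S N) * sum_n (fun i => lam (S i) / INR (S i)) N - INR (S N) <= INR (S N)).
  { rewrite <- S3; eapply Rle_trans; [exact S2|exact S1]. }
  apply Rmult_le_reg_l with (INR (S N)); lra.
Qed.

(** * Logarithms of integers and complex series *)

(** The shift by one lets sums over the positive integers start at index [0]. *)
Definition lnS (n : nat) : R := ln (INR (S n)).

Lemma INR_S_pos n : 0 < INR (S n).
Proof. apply lt_0_INR; lia. Qed.

Lemma lnS_0 : lnS 0 = 0.
Proof. apply ln_1. Qed.

Lemma ln_le_sub1 x : 0 < x -> ln x <= x - 1.
Proof. intros H; pose proof (exp_ineq1_le (ln x)); rewrite exp_ln in *; lra. Qed.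

Lemma lnS_step_lower n : / INR (S (S n)) <= lnS (S n) - lnS n.
Proof.
  pose proof (INR_S_pos n) as P; pose proof (INR_S_pos (S n)) as P'.
  unfold lnS; rewrite <- ln_div by auto.
  pose proof (ln_le_sub1 (INR (S n) / INR (S (S n)))) as H.
  rewrite ln_div in H by auto. rewrite ln_div by auto.
  assert (INR (S n) / INR (S (S n)) = 1 - / INR (S (S n))).
  { rewrite (S_INR (S n)) in *; field; lra. }
  assert (0 < INR (S n) / INR (S (S n))) by now apply Rdiv_lt_0_compat.
  specialize (H H1); lra.
Qed.

Lemma lnS_step_upper n : lnS (S n) - lnS n <= / INR (S n).
Proof.
  pose proof (INR_S_pos n) as P; pose proof (INR_S_pos (S n)) as P'.
  pose proof (ln_le_sub1 (INR (S (S n)) / INR (S n))) as H.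
  unfold lnS; rewrite ln_div in H by auto.
  assert (INR (S (S n)) / INR (S n) = 1 + / INR (S n)).
  { rewrite (S_INR (S n)) in *; field; lra. }
  assert (0 < INR (S (S n)) / INR (S n)) by now apply Rdiv_lt_0_compat.
  specialize (H H1); lra.
Qed.

Lemma lnS_step_pos n : 0 < lnS (S n) - lnS n.
Proof.
  pose proof (lnS_step_lower n); pose proof (Rinv_0_lt_compat _ (INR_S_pos (S n))); lra.
Qed.

Lemma lnS_step_le1 n : lnS (S n) - lnS n <= 1.
Proof.
  eapply Rle_trans; [apply lnS_step_upper|].
  rewrite <- Rinv_1; apply Rinv_le_contravar; [lra|].
  rewrite S_INR; pose proof (pos_INR n); lra.
Qed.

Lemma lnS_nonneg n : 0 <= lnS n.
Proof.
  induction n as [|n IH]; [rewrite lnS_0; lra|]. pose proof (lnS_step_pos n); lra.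
Qed.

Lemma exp_lnS n : exp (lnS n) = INR (S n).
Proof. apply exp_ln, INR_S_pos. Qed.

Lemma exp_neg_lnS n : exp (- lnS n) = / INR (S n).
Proof. now rewrite exp_Ropp, exp_lnS. Qed.

Lemma exp_le x y : x <= y -> exp x <= exp y.
Proof. intros [H| ->]; [left; now apply exp_increasing|right; auto]. Qed.

Lemma exp_diff_lower a b u : (b - a) * u * exp (- (b * u)) <= exp (- (a * u)) - exp (- (b * u)).
Proof.
  replace (- (a * u)) with (- (b * u) + (b - a) * u) by ring.
  rewrite exp_plus. pose proof (exp_ineq1_le ((b - a) * u)); pose proof (exp_pos (- (b * u))). nra.
Qed.

Lemma sum_telescope (f : nat -> R) N :
  sum_n (fun n => f n - f (S n)) N = f 0%nat - f (S N).
Proof.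
  induction N as [|N IH]; [now rewrite sum_O|]. rewrite sum_n_S, IH; rring.
Qed.

(** Comparison with [exp u / u] times the telescoping difference [(n+1)^(-u) - (n+2)^(-u)]. The
    factor [exp u] moves the exponential from the right end of a logarithmic step to its left end,
    the step having length at most [1]. *)
Lemma ex_series_lnS_step u : 0 < u ->
  ex_series (fun n => (lnS (S n) - lnS n) * exp (- (lnS n * u))).
Proof.
  intros Hu.
  destruct (series_bounded (fun n => (lnS (S n) - lnS n) * exp (- (lnS n * u))) (exp u / u)) as [l [Hl _]];
    [| |now exists l].
  - intros n; apply Rmult_le_pos; [left; apply lnS_step_pos|left; apply exp_pos].
  - intros N; apply Rle_trans with
      (sum_n (fun n => exp u / u * exp (- (lnS n * u)) - exp u / u * exp (- (lnS (S n) * u))) N).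
    + apply sum_n_le_compat; intros n _.
      pose proof (exp_diff_lower (lnS n) (lnS (S n)) u) as H.
      assert (E : exp (- (lnS n * u)) <= exp u * exp (- (lnS (S n) * u))).
      { rewrite <- exp_plus; apply exp_le. pose proof (lnS_step_le1 n); nra. }
      pose proof (lnS_step_pos n) as P; pose proof (exp_pos u).
      apply Rle_trans with ((lnS (S n) - lnS n) * (exp u * exp (- (lnS (S n) * u)))).
      { apply Rmult_le_compat_l; lra. }
      apply Rmult_le_reg_l with u; auto.
      replace (u * (exp u / u * exp (- (lnS n * u)) - exp u / u * exp (- (lnS (S n) * u)))) with
        (exp u * (exp (- (lnS n * u)) - exp (- (lnS (S n) * u)))) by (field; lra).
      nra.
    + rewrite (sum_telescope (fun n => exp u / u * exp (- (lnS n * u)))).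
      rewrite lnS_0, Rmult_0_l, Ropp_0, exp_0.
      assert (0 < exp u / u * exp (- (lnS (S N) * u))); [|lra].
      apply Rmult_lt_0_compat; [apply Rdiv_lt_0_compat; auto|]; apply exp_pos.
Qed.

(** [1 / (n + 2)] is at most a step of the logarithm, so [(n+2)^(-sigma)] is dominated by the
    preceding series with [u = sigma - 1]. *)
Lemma zeta_summable sigma : 1 < sigma -> ex_series (fun n => exp (- (lnS n * sigma))).
Proof.
  intros H. apply ex_series_incr_1.
  apply (ex_series_dom _ _) with (2 := ex_series_lnS_step (sigma - 1) ltac:(lra)).
  intros n; rewrite Rabs_pos_eq by (left; apply exp_pos).
  replace (- (lnS (S n) * sigma)) with (- lnS (S n) + - (lnS (S n) * (sigma - 1))) by ring.
  rewrite exp_plus, exp_neg_lnS.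
  apply Rmult_le_compat; [left; apply Rinv_0_lt_compat, INR_S_pos|left; apply exp_pos|apply lnS_step_lower|].
  apply exp_le; pose proof (lnS_step_pos n); nra.
Qed.

(** Componentwise convergence gives access to the real lemmas on domination and interchange;
    [cseries_iff] identifies it with convergence in norm. *)
Definition cseries (x : nat -> C) (l : C) : Prop :=
  is_series (fun n => fst (x n)) (fst l) /\ is_series (fun n => snd (x n)) (snd l).

Lemma sum_n_C (x : nat -> C) n :
  sum_n (G := C_AbelianMonoid) x n = (sum_n (fun n => fst (x n)) n, sum_n (fun n => snd (x n)) n).
Proof.
  induction n as [|n IH]; [rewrite !sum_O; now destruct (x 0%nat)|].
  now rewrite !sum_Sn, IH.
Qed.

Lemma cseries_iff x l : is_series (V := C_NormedModule) x l <-> cseries x l.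
Proof.
  split.
  - intros H.
    assert (B : forall eps : posreal, exists N, forall n, (N <= n)%nat ->
      Rabs (sum_n (fun n => fst (x n)) n - fst l) < eps /\
      Rabs (sum_n (fun n => snd (x n)) n - snd l) < eps).
    { intros eps.
      destruct (proj1 (filterlim_locally_ball_norm (K := C_AbsRing) (U := C_NormedModule) _ l) H eps) as [N HN].
      exists N; intros n Hn; specialize (HN n Hn).
      change (Cmod (Cminus (sum_n (G := C_AbelianMonoid) x n) l) < eps) in HN.
      rewrite sum_n_C in HN.
      pose proof (Rmax_Cmod (Cminus (sum_n (fun n => fst (x n)) n, sum_n (fun n => snd (x n)) n) l)) as M.
      unfold Cminus, Cplus, Copp in M; simpl in M.
      split; (eapply Rle_lt_trans; [|exact HN]); (eapply Rle_trans; [|exact M]); [apply Rmax_l|apply Rmax_r]. }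
    split; apply filterlim_locally; intros eps; destruct (B eps) as [N HN]; exists N; intros n Hn;
      apply (HN n Hn).
  - intros [H1 H2].
    apply (filterlim_locally_ball_norm (K := C_AbsRing) (U := C_NormedModule)); intros eps.
    assert (He : 0 < eps / 2) by (destruct eps; simpl; lra).
    destruct (proj1 (filterlim_locally (U := R_UniformSpace) _ (fst l)) H1 (mkposreal _ He)) as [N1 HN1].
    destruct (proj1 (filterlim_locally (U := R_UniformSpace) _ (snd l)) H2 (mkposreal _ He)) as [N2 HN2].
    exists (max N1 N2); intros n Hn.
    specialize (HN1 n ltac:(lia)); specialize (HN2 n ltac:(lia)).
    change (Rabs (sum_n (fun n => fst (x n)) n - fst l) < eps / 2) in HN1.
    change (Rabs (sum_n (fun n => snd (x n)) n - snd l) < eps / 2) in HN2.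
    change (Cmod (Cminus (sum_n (G := C_AbelianMonoid) x n) l) < eps).
    rewrite sum_n_C.
    eapply Rle_lt_trans; [apply Cmod_2Rmax|].
    assert (S2 : sqrt 2 < 2) by (rewrite <- (sqrt_square 2) at 2 by lra; apply sqrt_lt_1; lra).
    assert (M : Rmax (Rabs (sum_n (fun n => fst (x n)) n - fst l))
                     (Rabs (sum_n (fun n => snd (x n)) n - snd l)) < eps / 2).
    { apply Rmax_lub_lt; auto. }
    unfold Cminus, Cplus, Copp; simpl.
    assert (0 <= sqrt 2) by apply sqrt_pos.
    set (m := Rmax _ _) in *.
    change (sqrt 2 * m < eps).
    assert (0 <= m) by (eapply Rle_trans; [apply Rabs_pos|apply Rmax_l]).
    nra.
Qed.

(** * Dirichlet products and Abel summation *)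

Definition cexp (z : C) : C := (exp (Re z) * cos (Im z), exp (Re z) * sin (Im z)).

Lemma Cmod_cexp z : Cmod (cexp z) = exp (Re z).
Proof.
  unfold Cmod, cexp; simpl fst; simpl snd.
  replace ((exp (Re z) * cos (Im z)) ^ 2 + (exp (Re z) * sin (Im z)) ^ 2)
    with (exp (Re z) * exp (Re z)).
  - apply sqrt_square; left; apply exp_pos.
  - pose proof (sin2_cos2 (Im z)) as H; unfold Rsqr in H.
    transitivity (exp (Re z) * exp (Re z) * (sin (Im z) * sin (Im z) + cos (Im z) * cos (Im z))); [rewrite H|]; ring.
Qed.

Lemma cexp_plus z w : cexp (z + w)%C = (cexp z * cexp w)%C.
Proof.
  destruct z as [a b], w as [c d]; unfold cexp, Cmult, Cplus, Re, Im; simpl.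
  rewrite exp_plus, cos_plus, sin_plus; f_equal; ring.
Qed.

Lemma cexp_0 : cexp 0 = 1%C.
Proof. unfold cexp; simpl; now rewrite exp_0, cos_0, sin_0, Rmult_1_l, Rmult_0_r. Qed.

Lemma cpow_neg_cexp n s : cpow_neg (S n) s = cexp (- (RtoC (lnS n) * s))%C.
Proof.
  unfold cpow_neg, cexp, lnS; destruct s as [a b]; unfold Re, Im; simpl fst; simpl snd.
  f_equal; f_equal; f_equal; simpl; ring.
Qed.

Lemma Cmod_cpow_neg n s : Cmod (cpow_neg (S n) s) = exp (- (lnS n * Re s)).
Proof.
  rewrite cpow_neg_cexp, Cmod_cexp; f_equal; destruct s as [a b]; unfold Re; simpl; ring.
Qed.

Lemma cpow_neg_mul m n s :
  cpow_neg (S m * S n) s = (cpow_neg (S m) s * cpow_neg (S n) s)%C.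
Proof.
  replace (S m * S n)%nat with (S (S m * S n - 1)) by lia.
  rewrite !cpow_neg_cexp, <- cexp_plus; f_equal.
  replace (lnS (S m * S n - 1)) with (lnS m + lnS n).
  - rewrite RtoC_plus; ring.
  - unfold lnS; rewrite <- ln_mult by apply INR_S_pos.
    rewrite <- mult_INR; do 2 f_equal; lia.
Qed.

Lemma cpow_neg_sq n s : cpow_neg (S n * S n) s = cpow_neg (S n) (2 * s)%C.
Proof. rewrite cpow_neg_mul, !cpow_neg_cexp, <- cexp_plus; f_equal; ring. Qed.

Lemma cseries_eq x y l l' :
  cseries x l -> (forall n, x n = y n) -> l = l' -> cseries y l'.
Proof.
  intros [H1 H2] E <-; split; [apply (series_eq _ _ _ _ H1)|apply (series_eq _ _ _ _ H2)];
    auto; intros n; now rewrite E.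
Qed.

Lemma cseries_unique x l l' : cseries x l -> cseries x l' -> l = l'.
Proof.
  destruct l, l'; intros [H1 H2] [H3 H4]; f_equal; simpl in *; eapply series_unique; eauto.
Qed.

Lemma cseries_plus x y l l' :
  cseries x l -> cseries y l' -> cseries (fun n => (x n + y n)%C) (l + l')%C.
Proof. intros [H1 H2] [H3 H4]; split; now apply series_plus. Qed.

Lemma cseries_scal c x l : cseries x l -> cseries (fun n => (c * x n)%C) (c * l)%C.
Proof.
  destruct c as [a b]; intros [H1 H2]; split.
  - exact (series_minus _ _ _ _ (series_scal a _ _ H1) (series_scal b _ _ H2)).
  - exact (series_plus _ _ _ _ (series_scal a _ _ H2) (series_scal b _ _ H1)).
Qed.

Lemma Re_le_Cmod_abs z : Rabs (fst z) <= Cmod z.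
Proof. eapply Rle_trans; [apply Rmax_l|apply Rmax_Cmod]. Qed.

Lemma Im_le_Cmod_abs z : Rabs (snd z) <= Cmod z.
Proof. eapply Rle_trans; [apply Rmax_r|apply Rmax_Cmod]. Qed.

Lemma Cmod_le_abs z : Cmod z <= Rabs (fst z) + Rabs (snd z).
Proof.
  destruct z as [a b]; simpl.
  replace (a, b) with (RtoC a + Ci * RtoC b)%C.
  - eapply Rle_trans; [apply Cmod_triangle|].
    rewrite Cmod_mult, !Cmod_R, Cmod_Ci; lra.
  - unfold Cplus, Cmult; simpl; f_equal; ring.
Qed.

Lemma cseries_dom x b : (forall n, Cmod (x n) <= b n) -> ex_series b -> exists l, cseries x l.
Proof.
  intros H Hb.
  destruct (ex_series_dom (fun n => fst (x n)) b) as [l1 H1]; auto.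
  { intros n; eapply Rle_trans; [apply Re_le_Cmod_abs|auto]. }
  destruct (ex_series_dom (fun n => snd (x n)) b) as [l2 H2]; auto.
  { intros n; eapply Rle_trans; [apply Im_le_Cmod_abs|auto]. }
  now exists (l1, l2).
Qed.

Lemma Cmod_cseries_le x b l lb :
  (forall n, Cmod (x n) <= b n) -> cseries x l -> is_series b lb -> Cmod l <= 2 * lb.
Proof.
  intros H [H1 H2] Hb; eapply Rle_trans; [apply Cmod_le_abs|].
  assert (Rabs (fst l) <= lb).
  { apply (Rabs_series_le (fun n => fst (x n)) b); auto.
    intros n; eapply Rle_trans; [apply Re_le_Cmod_abs|auto]. }
  assert (Rabs (snd l) <= lb).
  { apply (Rabs_series_le (fun n => snd (x n)) b); auto.
    intros n; eapply Rle_trans; [apply Im_le_Cmod_abs|auto]. }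
  lra.
Qed.

Lemma cfubini (a : nat -> nat -> C) (e : nat -> nat -> R) (r : nat -> C) (R0 : nat -> R) :
  (forall i j, Cmod (a i j) <= e i j) -> (forall i, is_series (e i) (R0 i)) -> ex_series R0 ->
  (forall i, cseries (a i) (r i)) ->
  exists c l, (forall j, cseries (fun i => a i j) (c j)) /\ cseries c l /\ cseries r l.
Proof.
  intros B He HR Hr.
  destruct (fubini (fun i j => fst (a i j)) e (fun i => fst (r i)) R0) as [c1 [l1 [A1 [B1 C1]]]]; auto.
  { intros; eapply Rle_trans; [apply Re_le_Cmod_abs|auto]. }
  { intros i; apply (Hr i). }
  destruct (fubini (fun i j => snd (a i j)) e (fun i => snd (r i)) R0) as [c2 [l2 [A2 [B2 C2]]]]; auto.
  { intros; eapply Rle_trans; [apply Im_le_Cmod_abs|auto]. }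
  { intros i; apply (Hr i). }
  exists (fun j => (c1 j, c2 j)), (l1, l2); repeat split; simpl; auto.
Qed.

Lemma cseries_sparse (v b : nat -> C) (phi : nat -> nat) l :
  (forall k, (phi k < phi (S k))%nat) -> (forall k, b (phi k) = v k) ->
  (forall n, (forall k, phi k <> n) -> b n = 0) ->
  cseries v l -> cseries b l.
Proof.
  intros M Hv H0 [H1 H2]; split.
  - apply (series_sparse (fun n => fst (v n)) _ phi); auto; intros n; [now rewrite Hv|].
    intros Hn; now rewrite H0.
  - apply (series_sparse (fun n => snd (v n)) _ phi); auto; intros n; [now rewrite Hv|].
    intros Hn; now rewrite H0.
Qed.

Lemma cseries_multiples (v b : nat -> C) d l : (1 <= d)%nat ->
  (forall k, b (d * S k - 1)%nat = v k) ->
  (forall n, ~ Nat.divide d (S n) -> b n = 0) ->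
  cseries v l -> cseries b l.
Proof.
  intros Hd Hv H0; apply (cseries_sparse v b (fun k => d * S k - 1)%nat); auto; [nia|].
  intros n Hn; apply H0; intros [k Hk]. destruct k; [lia|]. apply (Hn k); lia.
Qed.

Lemma lnS_mul_sub1 i k : lnS (S i * S k - 1) = lnS i + lnS k.
Proof.
  unfold lnS; rewrite <- ln_mult by apply INR_S_pos.
  rewrite <- mult_INR; do 2 f_equal; lia.
Qed.

Section Dirichlet.
Variable lam : nat -> R.
Hypothesis HL : is_liouville lam.

Lemma liouville_term_mod s n :
  Cmod (RtoC (lam (S n)) * cpow_neg (S n) s)%C = exp (- (lnS n * Re s)).
Proof. rewrite Cmod_mult, Cmod_R, (liouville_abs lam HL), Cmod_cpow_neg by lia; ring. Qed.

Lemma zeta_series_ex s : 1 < Re s -> exists z, cseries (fun n => cpow_neg (S n) s) z.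
Proof.
  intros Hs; apply (cseries_dom _ _) with (2 := zeta_summable _ Hs).
  intros n; rewrite Cmod_cpow_neg; lra.
Qed.

Lemma liouville_series_ex s : 1 < Re s ->
  exists D, cseries (fun n => (RtoC (lam (S n)) * cpow_neg (S n) s)%C) D.
Proof.
  intros Hs; apply (cseries_dom _ _) with (2 := zeta_summable _ Hs).
  intros n; rewrite liouville_term_mod; lra.
Qed.

(** The array [a] carries [lam(i) j^(-s)] where [i] divides [j]. Row [i] sums to [lam(i) i^(-s) Z],
    so the rows give [D Z]. Column [j] is [j^(-s)] times the divisor sum of [lam], which leaves only
    [j = k k] with the term [k^(-2s)]. *)
Lemma liouville_zeta s Z D : 1 < Re s ->
  cseries (fun n => cpow_neg (S n) s) Z ->
  cseries (fun n => (RtoC (lam (S n)) * cpow_neg (S n) s)%C) D ->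
  cseries (fun n => cpow_neg (S n) (2 * s)%C) (D * Z)%C.
Proof.
  intros Hs HZ HD.
  destruct (zeta_summable _ Hs) as [Z0 HZ0].
  set (a := fun i j : nat => if dvd (S i) (S j) then (RtoC (lam (S i)) * cpow_neg (S j) s)%C else 0%C).
  set (e := fun i j : nat => if dvd (S i) (S j) then exp (- (lnS j * Re s)) else 0).
  destruct (cfubini a e (fun i => (RtoC (lam (S i)) * cpow_neg (S i) s * Z)%C)
              (fun i => exp (- (lnS i * Re s)) * Z0)) as [c [l [Hc [Hl Hr]]]].
  - intros i j; unfold a, e; destruct (dvd (S i) (S j)); [|rewrite Cmod_0; lra].
    rewrite Cmod_mult, Cmod_R, (liouville_abs lam HL), Cmod_cpow_neg by lia; lra.
  - intros i; apply (series_multiples (fun k => exp (- (lnS i * Re s)) * exp (- (lnS k * Re s))) _ (S i));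
      [lia| | |now apply series_scal].
    + intros k; unfold e; rewrite (proj2 (dvdP _ _)) by (exists (S k); lia).
      rewrite lnS_mul_sub1, <- exp_plus; f_equal; ring.
    + intros n D'; unfold e; now rewrite dvd_false.
  - exists (Z0 * Z0); apply (series_eq _ _ _ _ (series_scal Z0 _ _ HZ0)); auto; intros; simpl; rring.
  - intros i; apply (cseries_multiples (fun k => (RtoC (lam (S i)) * cpow_neg (S i) s * cpow_neg (S k) s)%C) _ (S i));
      [lia| | |now apply cseries_scal].
    + intros k; unfold a; rewrite (proj2 (dvdP _ _)) by (exists (S k); lia).
      replace (S (S i * S k - 1)) with (S i * S k)%nat by lia.
      rewrite cpow_neg_mul; ring.
    + intros n D'; unfold a; now rewrite dvd_false.
  - assert (El : l = (D * Z)%C).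
    { apply (cseries_unique _ _ _ Hr).
      rewrite Cmult_comm; apply (cseries_eq _ _ _ _ (cseries_scal Z _ _ HD)); auto; intros; ring. }
    assert (Ec : forall j, c j = if is_square (S j) then cpow_neg (S j) s else 0%C).
    { intros j; apply (cseries_unique _ _ _ (Hc j)).
      pose proof (div_sum_series lam (S j) ltac:(lia)) as S1.
      rewrite div_sum_square in S1 by (auto; lia).
      assert (S2 : cseries (fun i => RtoC (div_term lam (S j) i)) (if is_square (S j) then 1%C else 0%C)).
      { split; simpl; [now destruct (is_square (S j))|].
        (* The imaginary part is the zero series, obtained as [0] times [S1]. *)
        apply (series_eq (fun _ => 0 * div_term lam (S j) 0) _ (0 * 0)); [|intros; simpl; rring|destruct (is_square (S j)); simpl; ring].
        apply (series_eq _ _ _ _ (series_scal 0 _ _ S1)); intros; simpl; rring. }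
      apply (cseries_eq _ _ _ _ (cseries_scal (cpow_neg (S j) s) _ _ S2)).
      - intros i; unfold div_term, a; destruct (dvd (S i) (S j)); ring.
      - destruct (is_square (S j)); ring. }
    destruct (zeta_series_ex (2 * s)%C) as [Z2 HZ2].
    { destruct s; unfold Re in *; simpl in *; lra. }
    rewrite <- El; replace l with Z2; auto.
    apply (cseries_unique c); auto.
    apply (cseries_sparse (fun k => cpow_neg (S k) (2 * s)%C) _ (fun k => S k * S k - 1)%nat); auto.
    + intros k; nia.
    + intros k; rewrite Ec; replace (S (S k * S k - 1)) with (S k * S k)%nat by lia.
      rewrite (proj2 (is_squareP _)) by (now exists (S k)). apply cpow_neg_sq.
    + intros n Hn; rewrite Ec; destruct (is_square (S n)) eqn:E; auto.
      apply is_squareP in E as [k Hk]. destruct k; [lia|]. exfalso; apply (Hn k); lia.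
Qed.

End Dirichlet.

Lemma lnS_exp_lim d : 0 < d -> is_lim_seq (fun n => exp (- (lnS n * d))) 0.
Proof.
  intros Hd; apply is_lim_seq_spec; intros eps.
  destruct (archimed (exp (- ln eps / d))) as [A _].
  assert (0 < exp (- ln eps / d)) by apply exp_pos.
  exists (Z.to_nat (up (exp (- ln eps / d)))); intros n Hn.
  rewrite Rminus_0_r, Rabs_pos_eq by (left; apply exp_pos).
  assert (L : - ln eps / d < lnS n).
  { unfold lnS; rewrite <- (ln_exp (- ln eps / d)); apply ln_increasing; [apply exp_pos|].
    eapply Rlt_le_trans; [exact A|]. rewrite INR_IZR_INZ; apply IZR_le; lia. }
  rewrite <- (exp_ln eps) by apply cond_pos; apply exp_increasing.
  apply Rmult_lt_compat_r with (r := d) in L; auto.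
  unfold Rdiv in L; rewrite Rmult_assoc, Rinv_l in L by lra; lra.
Qed.

Lemma abel_sum (t p : nat -> R) B N :
  sum_n (fun n => (B - sum_n t n) * (p n - p (S n))) N =
  B * p 0%nat - sum_n (fun n => t n * p n) N - (B - sum_n t N) * p (S N).
Proof.
  induction N as [|N IH]; [rewrite !sum_O; rring|].
  rewrite !sum_n_S, IH; rring.
Qed.

(** Induction on [1 / sqrt (n+1) <= 2 (sqrt (n+1) - sqrt n)]. *)
Lemma sum_inv_sqrt (t : nat -> R) N : (forall n, Rabs (t n) <= exp (- (lnS n * / 2))) ->
  Rabs (sum_n t N) <= 2 * exp (lnS N * / 2).
Proof.
  intros H; induction N as [|N IH].
  - specialize (H 0%nat); rewrite sum_O, lnS_0, Rmult_0_l, Ropp_0, exp_0 in *; lra.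
  - rewrite sum_n_S. eapply Rle_trans; [apply Rabs_triang|].
    assert (exp (- (lnS (S N) * / 2)) <= 2 * (exp (lnS (S N) * / 2) - exp (lnS N * / 2))).
    { assert (E1 : forall n, exp (lnS n * / 2) * exp (lnS n * / 2) = INR (S n)).
      { intros n; rewrite <- exp_plus, <- exp_lnS; f_equal; field. }
      rewrite exp_Ropp. pose proof (E1 N) as F1; pose proof (E1 (S N)) as F2.
      rewrite (S_INR (S N)) in F2.
      pose proof (exp_pos (lnS N * / 2)); pose proof (exp_pos (lnS (S N) * / 2)).
      set (p := exp (lnS N * / 2)) in *; set (q := exp (lnS (S N) * / 2)) in *.
      apply Rmult_le_reg_l with q; auto. rewrite Rinv_r by lra. nra. }
    specialize (H (S N)); lra.
Qed.

(** The boundary term is [O(N^(1/2 - u))] by [sum_inv_sqrt] and tends to [0]. A general real weight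
    [p] serves both the real and the imaginary part of [n^(-w)]. *)
Lemma abel_series (t p : nat -> R) B u D : 1 / 2 < u ->
  (forall n, Rabs (t n) <= exp (- (lnS n * / 2))) ->
  (forall n, Rabs (p n) <= exp (- (lnS n * u))) ->
  is_series (fun n => t n * p n) D ->
  is_series (fun n => (B - sum_n t n) * (p n - p (S n))) (B * p 0%nat - D).
Proof.
  intros Hu Ht Hp HD.
  assert (L : is_lim_seq (fun N => (B - sum_n t N) * p (S N)) 0).
  { apply is_lim_seq_abs_0.
    apply (is_lim_seq_le_le (fun _ => 0) _ (fun N => (Rabs B + 2) * exp (- (lnS N * (u - / 2))))).
    - intros N; split; [apply Rabs_pos|]. rewrite Rabs_mult.
      pose proof (sum_inv_sqrt t N Ht) as H1. pose proof (Hp (S N)) as H2.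
      assert (H3 : exp (- (lnS (S N) * u)) <= exp (- (lnS N * u))).
      { apply exp_le; pose proof (lnS_step_pos N); nra. }
      assert (H4 : Rabs (B - sum_n t N) <= (Rabs B + 2) * exp (lnS N * / 2)).
      { unfold Rminus; eapply Rle_trans; [apply Rabs_triang|]; rewrite Rabs_Ropp.
        assert (1 <= exp (lnS N * / 2)).
        { rewrite <- exp_0; apply exp_le; pose proof (lnS_nonneg N); lra. }
        pose proof (Rabs_pos B); nra. }
      replace (- (lnS N * (u - / 2))) with (lnS N * / 2 + - (lnS N * u)) by ring.
      rewrite exp_plus, <- Rmult_assoc.
      apply Rmult_le_compat; [apply Rabs_pos|apply Rabs_pos|exact H4|lra].
    - apply is_lim_seq_const.
    - replace (Finite 0) with (Rbar_mult (Rabs B + 2) 0) by (simpl; f_equal; ring).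
      apply is_lim_seq_scal_l, lnS_exp_lim; lra. }
  change (is_lim_seq (sum_n (fun n => (B - sum_n t n) * (p n - p (S n)))) (B * p 0%nat - D)).
  apply (is_lim_seq_ext (fun N => (B * p 0%nat - sum_n (fun n => t n * p n) N) - (B - sum_n t N) * p (S N))).
  { intros N; symmetry; apply abel_sum. }
  replace (Finite (B * p 0%nat - D)) with (Finite (B * p 0%nat - D - 0)) by (f_equal; ring).
  apply is_lim_seq_minus'; auto.
  apply is_lim_seq_minus'; [apply is_lim_seq_const|exact HD].
Qed.

(** * The upper bound for the partial sums with weight [n^(-1/2)] *)

Definition t_half (lam : nat -> R) (n : nat) : R := lam (S n) * exp (- (lnS n * / 2)).

Lemma t_half_abs lam : is_liouville lam -> forall n, Rabs (t_half lam n) <= exp (- (lnS n * / 2)).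
Proof.
  intros HL n; unfold t_half; rewrite Rabs_mult, (liouville_abs lam HL) by lia.
  rewrite Rabs_pos_eq by (left; apply exp_pos); lra.
Qed.

(** The equation for [xi n] rewrites [n^(-1/2)] as [1/n] plus [(1/2) log(n) n^(-xi(n))]. At [n = 1]
    both powers are [1] and the correction vanishes with [a(1) = 0]. *)
Lemma S_part_half (lam xi : nat -> R) :
  (forall n : nat, (2 <= n)%nat ->
     / INR n - Rpower (INR n) (- (1 / 2)) = - (1 / 2) * ln (INR n) * Rpower (INR n) (- xi n)) ->
  forall N, sum_n (t_half lam) N = sum_n (fun i => lam (S i) / INR (S i)) N + / 2 * S_part lam xi (S N).
Proof.
  intros Hxi N; induction N as [|N IH].
  - rewrite !sum_O; simpl S_part; unfold t_half, a_fun.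
    rewrite lnS_0, Rmult_0_l, Ropp_0, exp_0; simpl; field.
    unfold Rpower; apply Rgt_not_eq, exp_pos.
  - rewrite !sum_n_S, IH.
    change (S_part lam xi (S (S N))) with (S_part lam xi (S N)
           + a_fun lam (S (S N)) * ln (INR (S (S N))) / Rpower (INR (S (S N))) (xi (S (S N)))).
    specialize (Hxi (S (S N)) ltac:(lia)).
    unfold a_fun; simpl Nat.leb; cbv iota.
    rewrite (Rpower_Ropp _ (xi _)) in Hxi.
    assert (E : t_half lam (S N) = lam (S (S N)) * Rpower (INR (S (S N))) (- (1 / 2))).
    { unfold t_half, Rpower, lnS; do 2 f_equal; field. }
    rewrite E.
    replace (Rpower (INR (S (S N))) (- (1 / 2))) with (/ INR (S (S N)) + 1 / 2 * ln (INR (S (S N))) *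
          / Rpower (INR (S (S N))) (xi (S (S N)))) by lra.
    unfold Rdiv; rring.
Qed.

Lemma t_half_bounded (lam xi : nat -> R) :
  is_liouville lam ->
  (forall n : nat, (2 <= n)%nat ->
     / INR n - Rpower (INR n) (- (1 / 2)) = - (1 / 2) * ln (INR n) * Rpower (INR n) (- xi n)) ->
  (exists r : R, 0 < r /\ exists X : R, forall x : R, X <= x -> L_x lam xi x <= 1 - r) ->
  exists B, forall N, sum_n (t_half lam) N <= B.
Proof.
  (* If [N + 1 >= X], the harmonic part is at most [2] and [L_x] is below [1], which gives [3]; for
     smaller [N] the trivial bound [N + 1 < X] is used. *)
  intros HL Hxi [r [Hr [X HX]]]; exists (3 + Rabs X); intros N.
  destruct (Rle_lt_dec X (INR (S N))) as [H|H].
  - specialize (HX _ H). unfold L_x in HX.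
    replace (Int_part (INR (S N))) with (Z.of_nat (S N)) in HX.
    + rewrite Nat2Z.id in HX. rewrite (S_part_half lam xi Hxi).
      pose proof (liouville_harmonic_bound lam HL N); pose proof (Rabs_pos X); lra.
    + apply Int_part_spec; rewrite INR_IZR_INZ; lra.
  - apply Rle_trans with (INR (S N)); [|pose proof (Rle_abs X); lra].
    replace (INR (S N)) with (sum_n (fun _ : nat => 1) N).
    + apply sum_n_le_compat; intros i _.
      eapply Rle_trans; [apply Rle_abs|]. eapply Rle_trans; [now apply t_half_abs|].
      rewrite <- exp_0; apply exp_le; pose proof (lnS_nonneg i); lra.
    + rewrite sum_n_const; apply Rmult_1_r.
Qed.

(** The factor [n^(-1/2)] is moved into [t_half], so that Abel summation acts on the partial sums
    bounded by hypothesis and the weight is [n^(-w)]. *)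
Lemma liouville_abel lam B w D : is_liouville lam -> 1 / 2 < Re w ->
  cseries (fun n => (RtoC (lam (S n)) * cpow_neg (S n) (w + RtoC (/ 2)))%C) D ->
  cseries (fun n => (RtoC (B - sum_n (t_half lam) n) * (cpow_neg (S n) w - cpow_neg (S (S n)) w))%C)
    (RtoC B - D)%C.
Proof.
  intros HL Hw [H1 H2].
  assert (E : forall n, cpow_neg (S n) (w + RtoC (/ 2))%C = (RtoC (exp (- (lnS n * / 2))) * cpow_neg (S n) w)%C).
  { intros n; rewrite !cpow_neg_cexp.
    replace (RtoC (exp (- (lnS n * / 2)))) with (cexp (- RtoC (lnS n * / 2))).
    - rewrite <- cexp_plus; f_equal; rewrite RtoC_mult; ring.
    - unfold cexp, RtoC, Re, Im; simpl; rewrite Ropp_0, cos_0, sin_0; f_equal; ring. }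
  assert (E0 : cpow_neg 1 w = 1%C).
  { rewrite cpow_neg_cexp, lnS_0; replace (- (0 * w))%C with (0 : C) by ring; apply cexp_0. }
  split.
  - apply (series_eq _ _ _ _ (abel_series (t_half lam) (fun n => fst (cpow_neg (S n) w)) B (Re w) (fst D) Hw
             (t_half_abs lam HL) (fun n => Rle_trans _ _ _ (Re_le_Cmod_abs _) (Req_le _ _ (Cmod_cpow_neg n w)))
             ltac:(refine (series_eq _ _ _ _ H1 _ eq_refl); intros n; rewrite E; unfold t_half; simpl; ring))).
    + intros n; simpl; ring.
    + rewrite E0; simpl; ring.
  - apply (series_eq _ _ _ _ (abel_series (t_half lam) (fun n => snd (cpow_neg (S n) w)) B (Re w) (snd D) Hw
             (t_half_abs lam HL) (fun n => Rle_trans _ _ _ (Im_le_Cmod_abs _) (Req_le _ _ (Cmod_cpow_neg n w)))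
             ltac:(refine (series_eq _ _ _ _ H2 _ eq_refl); intros n; rewrite E; unfold t_half; simpl; ring))).
    + intros n; simpl; ring.
    + rewrite E0; simpl; ring.
Qed.

(** * Landau's theorem *)

Definition cauchy (a b : nat -> R) (n : nat) : R := sum_f_R0 (fun k => a k * b (n - k)%nat) n.

Lemma geom_series C q : 0 <= q < 1 -> is_series (fun k => C * q ^ k) (C / (1 - q)).
Proof. intros H; apply series_scal, is_series_geom; rewrite Rabs_pos_eq; lra. Qed.

Lemma coef_abs_series (a : nat -> R) C M t : 0 < M -> Rabs t * M < 1 ->
  (forall k, Rabs (a k) <= C * M ^ k) -> ex_series (fun k => Rabs (a k * t ^ k)).
Proof.
  intros HM Ht H.
  apply (ex_series_dom _ (fun k => C * (Rabs t * M) ^ k)).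
  - intros k; rewrite Rabs_Rabsolu, Rabs_mult, <- RPow_abs, Rpow_mult_distr.
    replace (C * (Rabs t ^ k * M ^ k)) with (C * M ^ k * Rabs t ^ k) by ring.
    apply Rmult_le_compat_r; [apply pow_le, Rabs_pos|apply H].
  - eexists; apply geom_series; pose proof (Rabs_pos t); nra.
Qed.

Lemma cauchy_series (a b : nat -> R) t la lb :
  is_series (fun k => a k * t ^ k) la -> is_series (fun k => b k * t ^ k) lb ->
  ex_series (fun k => Rabs (a k * t ^ k)) -> ex_series (fun k => Rabs (b k * t ^ k)) ->
  is_series (fun k => cauchy a b k * t ^ k) (la * lb).
Proof.
  intros Ha Hb Ea Eb.
  apply (series_eq _ _ _ _ (is_series_mult _ _ _ _ Ha Hb Ea Eb)); [|reflexivity].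
  intros n; unfold cauchy; rewrite Rmult_comm, scal_sum; apply sum_eq; intros k Hk.
  replace (t ^ n) with (t ^ k * t ^ (n - k)); [ring|]. rewrite <- pow_add; f_equal; lia.
Qed.

Lemma series_at_0 (a : nat -> R) l : is_series (fun k => a k * 0 ^ k) l -> l = a 0%nat.
Proof.
  intros H; apply (series_unique _ _ _ H).
  replace (a 0%nat) with (sum_n (fun k => a k * 0 ^ k) 0) by (rewrite sum_O; simpl; rring).
  apply series_finite; intros n Hn; rewrite pow_ne_zero by lia; ring.
Qed.

Lemma power_series_zero (d : nat -> R) r : 0 < r ->
  (forall t, Rabs t <= r -> is_series (fun k => d k * t ^ k) 0) -> forall k, d k = 0.
Proof.
  intros Hr H k.
  assert (CV : Rbar_lt 0 (CV_radius d)).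
  { apply Rbar_lt_le_trans with r; [exact Hr|].
    apply Rbar_not_lt_le; intros A.
    rewrite <- (Rabs_pos_eq r) in A by lra.
    apply (CV_disk_outside d r A). 
    apply ex_series_lim_0; exists 0; apply H; rewrite Rabs_pos_eq; lra. }
  apply (PSeries_ext_recip d (fun _ => 0) k CV).
  - rewrite CV_radius_const_0; exact I.
  - exists (mkposreal r Hr); intros t Ht.
    change (Rabs (t - 0) < r) in Ht; rewrite Rminus_0_r in Ht.
    rewrite PSeries_const_0; apply is_pseries_unique, is_pseries_R, H; lra.
Qed.

Lemma power_series_unique (a b : nat -> R) F r : 0 < r ->
  (forall t, Rabs t <= r -> is_series (fun k => a k * t ^ k) (F t)) ->
  (forall t, Rabs t <= r -> is_series (fun k => b k * t ^ k) (F t)) ->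
  forall k, a k = b k.
Proof.
  intros Hr Ha Hb k.
  assert (a k - b k = 0); [|lra].
  apply (power_series_zero (fun k => a k - b k) r Hr); intros t Ht.
  apply (series_eq _ _ _ _ (series_minus _ _ _ _ (Ha t Ht) (Hb t Ht))); [intros n; simpl; rring|rring].
Qed.

Lemma sum_pow_rev r n : (r - 1) * sum_f_R0 (fun i => r ^ (n - i)) n = r ^ S n - 1.
Proof.
  induction n as [|n IH]; [simpl; ring|].
  rewrite tech5, Nat.sub_diag.
  rewrite (sum_eq _ (fun i => r ^ (n - i) * r)).
  - rewrite <- scal_sum, Rmult_plus_distr_l.
    replace ((r - 1) * (r * sum_f_R0 (fun i => r ^ (n - i)) n)) with (r * ((r - 1) * sum_f_R0 (fun i => r ^ (n - i)) n)) by ring.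
    rewrite IH; simpl; ring.
  - intros i Hi; replace (S n - i)%nat with (S (n - i)) by lia; simpl; ring.
Qed.

(** Induction on [Q_0 f_k = K_k - sum_(i >= 1) Q_i f_(k-i)] with the ansatz [F (r M)^k]. The choice
    [r - 1 = 2 C / q] makes the geometric sum cost at most half of [q F (r M)^k], and [F = 2 C / q]
    leaves the other half for [K_k]. *)
Lemma quotient_coef_bound (Q K f : nat -> R) C M q : 0 < C -> 0 < M -> 0 < q ->
  q <= Rabs (Q 0%nat) ->
  (forall k, Rabs (Q k) <= C * M ^ k) -> (forall k, Rabs (K k) <= C * M ^ k) ->
  (forall k, cauchy Q f k = K k) ->
  forall k, Rabs (f k) <= 2 * C / q * ((1 + 2 * C / q) * M) ^ k.
Proof.
  intros HC HM Hq HQ0 HQ HK E k.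
  set (r := 1 + 2 * C / q). set (F := 2 * C / q).
  assert (HF : 0 < F) by (unfold F; apply Rdiv_lt_0_compat; lra).
  assert (Hr : 1 < r) by (unfold r; fold F; lra).
  induction k as [k IH] using (well_founded_induction lt_wf).
  apply Rmult_le_reg_l with q; auto.
  apply Rle_trans with (Rabs (Q 0%nat * f k)).
  { rewrite Rabs_mult; apply Rmult_le_compat_r; [apply Rabs_pos|auto]. }
  specialize (E k); unfold cauchy in E.
  destruct k as [|k].
  - simpl in E; rewrite E; simpl. specialize (HK 0%nat); simpl in HK.
    replace (q * (F * 1)) with (2 * C) by (unfold F; field; lra). lra.
  - rewrite decomp_sum in E by lia; rewrite Nat.sub_0_r in E; simpl Init.Nat.pred in E.
    replace (Q 0%nat * f (S k)) with (K (S k) - sum_f_R0 (fun i => Q (S i) * f (S k - S i)%nat) k) by lra.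
    assert (B : Rabs (sum_f_R0 (fun i => Q (S i) * f (S k - S i)%nat) k) <=
                C * F * M ^ S k * sum_f_R0 (fun i => r ^ (k - i)) k).
    { eapply Rle_trans; [apply Rsum_abs|].
      rewrite scal_sum; apply sum_Rle; intros i Hi.
      rewrite Rabs_mult. simpl (S k - S i)%nat.
      assert (H1 := HQ (S i)). assert (H2 := IH (k - i)%nat ltac:(lia)).
      rewrite Rpow_mult_distr in H2.
      apply Rle_trans with (C * M ^ S i * (F * (r ^ (k - i) * M ^ (k - i)))).
      { apply Rmult_le_compat; auto; apply Rabs_pos. }
      right. replace (M ^ S k) with (M ^ S i * M ^ (k - i)); [ring|].
      rewrite <- pow_add; f_equal; lia. }
    assert (S1 := sum_pow_rev r k). set (S0 := sum_f_R0 (fun i => r ^ (k - i)) k) in *.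
    assert (HMk : 0 < M ^ S k) by now apply pow_lt.
    assert (S2 : C * S0 <= q / 2 * r ^ S k).
    { replace (C * S0) with (q / 2 * ((r - 1) * S0)) by (unfold r; field; lra).
      apply Rmult_le_compat_l; lra. }
    unfold Rminus; eapply Rle_trans; [apply Rabs_triang|]; rewrite Rabs_Ropp.
    rewrite Rpow_mult_distr.
    assert (S3 : C * F * M ^ S k * S0 <= q / 2 * F * (r ^ S k * M ^ S k)).
    { replace (C * F * M ^ S k * S0) with (F * M ^ S k * (C * S0)) by ring.
      replace (q / 2 * F * (r ^ S k * M ^ S k)) with (F * M ^ S k * (q / 2 * r ^ S k)) by ring.
      apply Rmult_le_compat_l; [|auto]. apply Rmult_le_pos; lra. }
    assert (S4 : C * M ^ S k <= q / 2 * F * (r ^ S k * M ^ S k)).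
    { replace (q / 2 * F) with C by (unfold F; field; lra).
      assert (1 <= r ^ S k) by (apply pow_R1_Rle; lra).
      apply Rmult_le_compat_l; [lra|]. nra. }
    specialize (HK (S k)). lra.
Qed.

(** Expanding leftwards, in [t] at [x - t], turns alternating derivatives into nonnegative
    coefficients. One pair [C], [M] serves all centres, which is what fixes the step length later;
    the expansion itself may leave [[lo, hi]]. *)
Definition unif_analytic (lo hi : R) (F : R -> R) : Prop :=
  exists C M, 0 < C /\ 0 < M /\ forall x, lo <= x <= hi ->
    exists a : nat -> R, (forall k, Rabs (a k) <= C * M ^ k) /\
      forall t, Rabs t * M < 1 -> is_series (fun k => a k * t ^ k) (F (x - t)).

(** The core of Landau's argument: at [rho] all terms are nonnegative and may be summed in either
    order, and the array at [rho] dominates the array at any [t] with [|t| <= rho]. Convergence of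
    the coefficient series thus forces convergence of the original series [v]. *)
Lemma nonneg_swap (cf : nat -> nat -> R) (phi v : nat -> R) rho t :
  (forall n k, 0 <= cf n k) -> (forall k, is_series (fun n => cf n k) (phi k)) ->
  0 <= rho -> Rabs t <= rho -> ex_series (fun k => phi k * rho ^ k) ->
  (forall n, is_series (fun k => cf n k * t ^ k) (v n)) ->
  exists l, is_series v l /\ is_series (fun k => phi k * t ^ k) l.
Proof.
  intros P Hphi Hrho Ht [L HL] Hv.
  assert (Pe : forall n, 0 <= rho ^ n) by (intros; now apply pow_le).
  destruct (tonelli (fun k n => cf n k * rho ^ k) (fun k => phi k * rho ^ k) L) as [c [Hc Sc]]; auto.
  { intros; now apply Rmult_le_pos. }
  { intros k; rewrite Rmult_comm.
    apply (series_eq _ _ _ _ (series_scal (rho ^ k) _ _ (Hphi k))); auto; intros; simpl; rring. }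
  destruct (fubini (fun n k => cf n k * t ^ k) (fun n k => cf n k * rho ^ k) v c) as [d [l [H1 [H2 H3]]]]; auto.
  { intros n k; rewrite Rabs_mult, (Rabs_pos_eq (cf n k)) by auto.
    apply Rmult_le_compat_l; auto. rewrite <- RPow_abs; apply pow_incr; split; auto; apply Rabs_pos. }
  { now exists L. }
  exists l; split; auto.
  apply (series_eq _ _ _ _ H2); auto.
  intros k; apply (series_unique _ _ _ (H1 k)). rewrite Rmult_comm.
  apply (series_eq _ _ _ _ (series_scal (t ^ k) _ _ (Hphi k))); auto; intros; simpl; rring.
Qed.

Section Landau.
Variables (c : nat -> R -> R) (coef : nat -> R -> nat -> R) (Q K : R -> R) (lo mid hi q : R).
Hypothesis coef_pos : forall n x k, 0 < x -> 0 <= coef n x k.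
Hypothesis coef_sum : forall n x t, 0 < x -> Rabs t < x ->
  is_series (fun k => coef n x k * t ^ k) (c n (x - t)).
Hypothesis HQ : unif_analytic lo hi Q.
Hypothesis HK : unif_analytic lo hi K.
Hypothesis Hq : 0 < q.
Hypothesis Q_low : forall x, lo <= x <= hi -> q <= Q x.
Hypothesis Hlo : 0 < lo.
Hypothesis Hmid : lo <= mid < hi.

(** Requiring the whole of [[x, hi]] gives the centre [x + tau] a two-sided neighbourhood on which
    [Q f = K] holds and determines Taylor coefficients. *)
Let good (x : R) : Prop :=
  forall y, x <= y <= hi -> exists f, is_series (fun n => c n y) f /\ Q y * f = K y.

(* The Taylor coefficients of the sum are nonnegative and, by the quotient equation,
   bounded independently of the centre [x + tau]; this extends convergence to [x - tau]. *)
Lemma landau_step : exists tau, 0 < tau /\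
  forall x, lo <= x <= mid -> good x -> good (x - tau).
Proof.
  destruct HQ as [C1 [M1 [HC1 [HM1 HQ']]]], HK as [C2 [M2 [HC2 [HM2 HK']]]].
  set (C := C1 + C2). set (M := M1 + M2).
  assert (HC : 0 < C) by (unfold C; lra). assert (HM : 0 < M) by (unfold M; lra).
  set (r := 1 + 2 * C / q).
  assert (Hr : 1 < r) by (unfold r; assert (0 < 2 * C / q) by (apply Rdiv_lt_0_compat; lra); lra).
  assert (HrM : 0 < r * M) by nra.
  (* The first bound gives [2 tau r M <= 1/2], so the coefficient estimate converges at [2 tau];
     [lo / 4] keeps [2 tau] below the centre, where the termwise expansions hold; the last keeps
     [x + 2 tau <= hi]. *)
  set (tau := Rmin (/ (4 * (r * M))) (Rmin (lo / 4) ((hi - mid) / 2))).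
  assert (T1 : tau <= / (4 * (r * M))) by apply Rmin_l.
  assert (T2 : tau <= lo / 4) by (eapply Rle_trans; [apply Rmin_r|apply Rmin_l]).
  assert (T3 : tau <= (hi - mid) / 2) by (eapply Rle_trans; [apply Rmin_r|apply Rmin_r]).
  assert (T0 : 0 < tau).
  { apply Rmin_glb_lt; [apply Rinv_0_lt_compat; lra|apply Rmin_glb_lt; lra]. }
  assert (T4 : tau * (r * M) <= / 4).
  { apply Rmult_le_compat_r with (r := r * M) in T1; [|lra].
    replace (/ (4 * (r * M)) * (r * M)) with (/ 4) in T1 by (field; nra). exact T1. }
  exists tau; split; auto.
  intros x Hx G. set (x0 := x + tau).
  destruct (HQ' x0) as [Qa [BQ SQ]]; [unfold x0; lra|].
  destruct (HK' x0) as [Ka [BK SK]]; [unfold x0; lra|].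
  assert (PM : forall k, 0 <= M1 ^ k /\ 0 <= M2 ^ k /\ M1 ^ k <= M ^ k /\ M2 ^ k <= M ^ k).
  { intros k; repeat split; try (apply pow_le; lra); apply pow_incr; unfold M; lra. }
  assert (BQ' : forall k, Rabs (Qa k) <= C * M ^ k).
  { intros k; specialize (BQ k); destruct (PM k) as [p1 [p2 [p3 p4]]].
    eapply Rle_trans; [apply BQ|]. apply Rmult_le_compat; unfold C; lra. }
  assert (BK' : forall k, Rabs (Ka k) <= C * M ^ k).
  { intros k; specialize (BK k); destruct (PM k) as [p1 [p2 [p3 p4]]].
    eapply Rle_trans; [apply BK|]. apply Rmult_le_compat; unfold C; lra. }
  assert (small : forall t, Rabs t <= 2 * tau -> Rabs t * M < 1 /\ Rabs t * M1 < 1 /\ Rabs t * M2 < 1).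
  { intros t Ht. pose proof (Rabs_pos t).
    assert (Rabs t * M < 1).
    { apply Rle_lt_trans with (2 * tau * M); [apply Rmult_le_compat_r; lra|].
      assert (tau * M <= tau * (r * M)); [|lra].
      apply Rmult_le_compat_l; nra. }
    unfold M in *; repeat split; nra. }
  assert (Px0 : 0 < x0) by (unfold x0; lra).
  set (cf := fun n k => coef n x0 k).
  assert (Pcf : forall n k, 0 <= cf n k) by (intros; now apply coef_pos).
  assert (Ptau : forall k, 0 < tau ^ k) by (intros; now apply pow_lt).
  destruct (G x ltac:(lra)) as [fx [Sfx _]].
  destruct (tonelli (fun n k => cf n k * tau ^ k) (fun n => c n x) fx) as [ck [Hck Sck]]; auto.
  { intros; apply Rmult_le_pos; auto; left; auto. }
  { intros n. replace x with (x0 - tau) by (unfold x0; ring). apply coef_sum; auto.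
    rewrite Rabs_pos_eq by lra; unfold x0; lra. }
  set (phi := fun k => ck k / tau ^ k).
  assert (Hphi : forall k, is_series (fun n => cf n k) (phi k)).
  { intros k; apply (series_eq _ _ _ _ (series_scal (/ tau ^ k) _ _ (Hck k))).
    - intros n; simpl; field; apply Rgt_not_eq, Ptau.
    - unfold phi, Rdiv; rring. }
  assert (Pphi : forall k, 0 <= phi k) by (intros k; apply (series_nonneg (fun n => cf n k)); auto).
  assert (Ephi : ex_series (fun k => phi k * tau ^ k)).
  { exists fx; apply (series_eq _ _ _ _ Sck); auto. intros k; unfold phi; change (ck k = ck k / tau ^ k * tau ^ k); field; apply Rgt_not_eq, Ptau. }
  assert (Row : forall t, Rabs t <= 2 * tau -> forall n, is_series (fun k => cf n k * t ^ k) (c n (x0 - t))).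
  { intros t Ht n; apply coef_sum; auto; unfold x0; lra. }
  assert (Abs : forall rho t, Rabs t <= rho -> ex_series (fun k => phi k * rho ^ k) ->
             ex_series (fun k => Rabs (phi k * t ^ k))).
  { intros rho t Ht; apply ex_series_dom; intros k.
    rewrite Rabs_Rabsolu, Rabs_mult, (Rabs_pos_eq (phi k)) by auto.
    apply Rmult_le_compat_l; auto. rewrite <- RPow_abs; apply pow_incr; split; auto; apply Rabs_pos. }
  assert (Prod : forall rho t, Rabs t <= rho -> rho <= 2 * tau -> ex_series (fun k => phi k * rho ^ k) ->
             exists l, is_series (fun n => c n (x0 - t)) l /\
               is_series (fun k => cauchy Qa phi k * t ^ k) (Q (x0 - t) * l)).
  { intros rho t Ht Hrho Er. destruct (small t ltac:(lra)) as [s0 [s1 s2]].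
    destruct (nonneg_swap cf phi (fun n => c n (x0 - t)) rho t) as [l [H1 H2]]; auto.
    - pose proof (Rabs_pos t); lra.
    - apply Row; lra.
    - exists l; split; auto. apply cauchy_series; auto.
      + now apply (coef_abs_series Qa C M).
      + now apply (Abs rho). }
  (* For [|t| <= tau] the product series sums to [K (x0 - t)]; uniqueness of coefficients gives the
     recursion behind the bound on [phi]. *)
  assert (E : forall k, cauchy Qa phi k = Ka k).
  { apply (power_series_unique _ _ (fun t => K (x0 - t)) tau T0).
    - intros t Ht. destruct (Prod tau t Ht ltac:(lra) Ephi) as [l [H1 H2]].
      destruct (G (x0 - t)) as [f [H3 H4]].
      { apply Rabs_le_between in Ht; unfold x0; lra. }
      rewrite <- H4, <- (series_unique _ _ _ H1 H3); exact H2.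
    - intros t Ht; apply SK, small; lra. }
  assert (Bphi : forall k, Rabs (phi k) <= 2 * C / q * (r * M) ^ k).
  { apply (quotient_coef_bound Qa Ka phi C M q); auto.
    assert (E0 : Q (x0 - 0) = Qa 0%nat).
    { apply series_at_0, SQ; rewrite Rabs_R0; lra. }
    rewrite <- E0, Rminus_0_r. eapply Rle_trans; [|apply Rle_abs]. apply Q_low; unfold x0; lra. }
  (* The radius has doubled: [x0 - 2 tau = x - tau] is now within reach. *)
  assert (E2 : ex_series (fun k => phi k * (2 * tau) ^ k)).
  { apply ex_series_Rabs, (coef_abs_series phi (2 * C / q) (r * M)); auto.
    rewrite Rabs_pos_eq by lra; lra. }
  intros y Hy. destruct (Rle_lt_dec x y) as [L|L]; [apply G; lra|].
  set (t := x0 - y). assert (Ht : Rabs t <= 2 * tau).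
  { unfold t, x0; rewrite Rabs_pos_eq; lra. }
  destruct (Prod (2 * tau) t Ht ltac:(lra) E2) as [l [H1 H2]].
  replace (x0 - t) with y in * by (unfold t; ring).
  exists l; split; auto.
  assert (H3 : is_series (fun k => Ka k * t ^ k) (K (x0 - t))) by (apply SK, small; lra).
  replace (x0 - t) with y in H3 by (unfold t; ring).
  apply (series_unique _ _ _ H2). apply (series_eq _ _ _ _ H3); auto. intros k; now rewrite E.
Qed.

(** As [tau] does not depend on the centre, [(mid - lo) / tau] steps, rounded up, reach [lo]. *)
Lemma landau : good mid -> exists f, is_series (fun n => c n lo) f.
Proof.
  intros G0. destruct landau_step as [tau [Ht Step]].
  assert (H : forall n x, lo <= x -> mid - INR n * tau <= x -> good x).
  { induction n as [|n IH]; intros x Hx Hn.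
    - simpl in Hn; intros y Hy; apply G0; lra.
    - rewrite S_INR in Hn. pose proof (Rmin_l mid (x + tau)). pose proof (Rmin_r mid (x + tau)).
      (* The minimum with [mid] keeps the starting point where a step is allowed, and the point
         reached is still at most [x]. *)
      assert (G1 : good (Rmin mid (x + tau) - tau)).
      { apply Step; [split; auto; apply Rmin_glb; lra|].
        apply IH; apply Rmin_glb; try lra. pose proof (pos_INR n); nra. }
      intros y Hy; apply G1; lra. }
  destruct (archimed ((mid - lo) / tau)) as [A _].
  destruct (H (Z.to_nat (up ((mid - lo) / tau))) lo ltac:(lra)) with (y := lo) as [f [Hf _]]; [|lra|now exists f].
  assert (0 <= (mid - lo) / tau) by (apply Rdiv_le_0_compat; lra).
  rewrite INR_IZR_INZ, Z2Nat.id by (apply le_IZR; lra).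
  apply Rmult_gt_compat_r with (r := tau) in A; auto.
  unfold Rdiv in A; rewrite Rmult_assoc, Rinv_l in A by lra; lra.
Qed.
End Landau.

(** * Uniformly analytic functions *)

Lemma unif_analytic_const lo hi c : unif_analytic lo hi (fun _ => c).
Proof.
  exists (Rabs c + 1), 1; pose proof (Rabs_pos c); repeat split; try lra.
  intros x Hx; exists (fun k => match k with O => c | _ => 0 end); split.
  - intros [|k]; [simpl; lra|]. rewrite Rabs_R0, pow1; lra.
  - intros t _. apply (series_eq (fun k => match k with O => c | _ => 0 end * t ^ k) _
      (sum_n (fun k => match k with O => c | _ => 0 end * t ^ k) 0)); auto.
    + apply series_finite; intros [|n] Hn; [lia|simpl; ring].
    + rewrite sum_O; simpl; rring.
Qed.

Lemma unif_analytic_id lo hi : unif_analytic lo hi (fun y => y).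
Proof.
  exists (Rabs lo + Rabs hi + 1), 1; pose proof (Rabs_pos lo); pose proof (Rabs_pos hi).
  repeat split; try lra.
  intros x Hx; exists (fun k => match k with O => x | S O => -1 | _ => 0 end); split.
  - intros [|[|k]]; rewrite pow1.
    + pose proof (Rle_abs hi); pose proof (Rle_abs (- lo)); rewrite Rabs_Ropp in *.
      apply Rabs_le; lra.
    + rewrite Rabs_left by lra; lra.
    + rewrite Rabs_R0; lra.
  - intros t _. apply (series_eq (fun k => match k with O => x | S O => -1 | _ => 0 end * t ^ k) _
      (sum_n (fun k => match k with O => x | S O => -1 | _ => 0 end * t ^ k) 1)); auto.
    + apply series_finite; intros [|[|n]] Hn; [lia|lia|simpl; ring].
    + rewrite sum_n_S, sum_O; simpl; rring.
Qed.

Lemma pow_mono a b k : 0 <= a <= b -> 0 <= a ^ k <= b ^ k.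
Proof. intros H; split; [apply pow_le; lra|apply pow_incr; lra]. Qed.

Lemma unif_analytic_minus lo hi F G :
  unif_analytic lo hi F -> unif_analytic lo hi G -> unif_analytic lo hi (fun y => F y - G y).
Proof.
  intros [C1 [M1 [HC1 [HM1 H1]]]] [C2 [M2 [HC2 [HM2 H2]]]].
  exists (C1 + C2), (M1 + M2); repeat split; try lra.
  intros x Hx; destruct (H1 x Hx) as [a [Ba Sa]], (H2 x Hx) as [b [Bb Sb]].
  exists (fun k => a k - b k); split.
  - intros k; unfold Rminus; eapply Rle_trans; [apply Rabs_triang|]; rewrite Rabs_Ropp.
    pose proof (pow_mono M1 (M1 + M2) k ltac:(lra)); pose proof (pow_mono M2 (M1 + M2) k ltac:(lra)).
    specialize (Ba k); specialize (Bb k); nra.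
  - intros t Ht; pose proof (Rabs_pos t).
    apply (series_eq _ _ _ _ (series_minus _ _ _ _ (Sa t ltac:(nra)) (Sb t ltac:(nra)))); auto.
    intros; simpl; ring.
Qed.

Lemma INR_S_le_pow2 n : INR (S n) <= 2 ^ n.
Proof.
  induction n as [|n IH]; [simpl; lra|].
  rewrite S_INR; change (2 ^ S n) with (2 * 2 ^ n).
  assert (1 <= 2 ^ n) by (apply pow_R1_Rle; lra); lra.
Qed.

(** A coefficient of the product has [k + 1] terms, and [k + 1 <= 2^k] absorbs their number into the
    doubled ratio [2 M]. *)
Lemma unif_analytic_mult lo hi F G :
  unif_analytic lo hi F -> unif_analytic lo hi G -> unif_analytic lo hi (fun y => F y * G y).
Proof.
  intros [C1 [M1 [HC1 [HM1 H1]]]] [C2 [M2 [HC2 [HM2 H2]]]].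
  set (M := M1 + M2).
  exists (C1 * C2), (2 * M); unfold M; repeat split; try nra.
  fold M. intros x Hx; destruct (H1 x Hx) as [a [Ba Sa]], (H2 x Hx) as [b [Bb Sb]].
  exists (cauchy a b); split.
  - intros k; unfold cauchy. eapply Rle_trans; [apply Rsum_abs|].
    apply Rle_trans with (sum_f_R0 (fun _ => C1 * C2 * M ^ k) k).
    + apply sum_Rle; intros i Hi; rewrite Rabs_mult.
      apply Rle_trans with ((C1 * M ^ i) * (C2 * M ^ (k - i))).
      * pose proof (pow_mono M1 M i ltac:(unfold M; lra)); pose proof (pow_mono M2 M (k - i) ltac:(unfold M; lra)).
        apply Rmult_le_compat; try apply Rabs_pos; eapply Rle_trans; [apply Ba| |apply Bb|];
          apply Rmult_le_compat_l; lra.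
      * right; replace (M ^ k) with (M ^ i * M ^ (k - i)); [ring|].
        rewrite <- pow_add; f_equal; lia.
    + rewrite sum_cte, Rpow_mult_distr.
      pose proof (INR_S_le_pow2 k). assert (0 < M ^ k) by (apply pow_lt; unfold M; lra).
      rewrite Rmult_assoc. replace (C1 * C2 * (2 ^ k * M ^ k)) with (C1 * C2 * (M ^ k * 2 ^ k)) by ring.
      apply Rmult_le_compat_l; nra.
  - intros t Ht; pose proof (Rabs_pos t).
    assert (Rabs t * M1 < 1 /\ Rabs t * M2 < 1) as [t1 t2] by (unfold M in Ht; split; nra).
    apply cauchy_series; auto; [now apply (coef_abs_series a C1 M1)|now apply (coef_abs_series b C2 M2)].
Qed.

Lemma unif_analytic_shift lo hi c F :
  unif_analytic (lo + c) (hi + c) F -> unif_analytic lo hi (fun y => F (y + c)).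
Proof.
  intros [C [M [HC [HM H]]]]; exists C, M; repeat split; auto.
  intros x Hx; destruct (H (x + c)) as [a [Ba Sa]]; [lra|].
  exists a; split; auto. intros t Ht; replace (x - t + c) with (x + c - t) by ring; auto.
Qed.

(** A Weierstrass test on coefficients: the majorant [m n * M ^ k] is a summable family times a
    geometric one, so for [|t| M < 1] the double series can be rearranged. *)
Lemma unif_analytic_series lo hi (F : nat -> R -> R) (a : nat -> R -> nat -> R) (m : nat -> R) M :
  0 < M -> ex_series m ->
  (forall n x k, lo <= x <= hi -> Rabs (a n x k) <= m n * M ^ k) ->
  (forall n x t, lo <= x <= hi -> Rabs t * M < 1 -> is_series (fun k => a n x k * t ^ k) (F n (x - t))) ->
  unif_analytic lo hi (fun y => Series (fun n => F n y)) /\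
  (forall x, lo <= x <= hi -> ex_series (fun n => F n x)).
Proof.
  intros HM [L HL] B S0.
  assert (K : forall x t, lo <= x <= hi -> Rabs t * M < 1 ->
    exists l, is_series (fun n => F n (x - t)) l /\
      is_series (fun k => Series (fun n => a n x k) * t ^ k) l /\
      forall k, is_series (fun n => a n x k) (Series (fun n => a n x k))).
  { intros x t Hx Ht.
    assert (Hc : forall k, is_series (fun n => a n x k) (Series (fun n => a n x k))).
    { intros k; apply Series_correct, (ex_series_dom _ (fun n => M ^ k * m n)).
      - intros n; rewrite (Rmult_comm (M ^ k)); auto.
      - exists (M ^ k * L); now apply series_scal. }
    destruct (fubini (fun n k => a n x k * t ^ k) (fun n k => m n * (Rabs t * M) ^ k)
      (fun n => F n (x - t)) (fun n => m n / (1 - Rabs t * M))) as [d [l [H1 [H2 H3]]]].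
    - intros n k; rewrite Rabs_mult, <- RPow_abs, Rpow_mult_distr.
      replace (m n * (Rabs t ^ k * M ^ k)) with (m n * M ^ k * Rabs t ^ k) by ring.
      apply Rmult_le_compat_r; auto. apply pow_le, Rabs_pos.
    - intros n; apply geom_series; pose proof (Rabs_pos t); nra.
    - exists (/ (1 - Rabs t * M) * L).
      apply (series_eq _ _ _ _ (series_scal (/ (1 - Rabs t * M)) _ _ HL)); auto.
      intros n; simpl; unfold Rdiv; ring.
    - intros n; auto.
    - exists l; repeat split; auto.
      apply (series_eq _ _ _ _ H2); auto.
      intros k; apply (series_unique _ _ _ (H1 k)); rewrite Rmult_comm.
      apply (series_eq _ _ _ _ (series_scal (t ^ k) _ _ (Hc k))); auto; intros; simpl; ring. }
  split.
  - exists (Rabs L + 1), M; pose proof (Rabs_pos L); repeat split; auto; try lra.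
    intros x Hx; exists (fun k => Series (fun n => a n x k)); split.
    + intros k. destruct (K x 0 Hx) as [l [_ [_ Hc]]]; [rewrite Rabs_R0; lra|].
      apply Rle_trans with (M ^ k * L).
      * apply (Rabs_series_le (fun n => a n x k) (fun n => M ^ k * m n)); auto; [|now apply series_scal].
        intros n; rewrite (Rmult_comm (M ^ k)); auto.
      * rewrite Rmult_comm; apply Rmult_le_compat_r; [apply pow_le; lra|]. pose proof (Rle_abs L); lra.
    + intros t Ht; destruct (K x t Hx Ht) as [l [H1 [H2 _]]].
      now rewrite (is_series_unique _ _ H1).
  - intros x Hx. destruct (K x 0 Hx) as [l [H1 _]]; [rewrite Rabs_R0; lra|].
    exists l; now rewrite Rminus_0_r in H1.
Qed.

(** * Taylor coefficients of exponentials *)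

Definition powfact (k : nat) (u : R) : R := u ^ k / INR (fact k).

Lemma powfact_nonneg k u : 0 <= u -> 0 <= powfact k u.
Proof.
  intros H; apply Rdiv_le_0_compat; [now apply pow_le|apply INR_fact_lt_0].
Qed.

Lemma powfact_derive k u : is_derive (powfact (S k)) u (powfact k u).
Proof.
  assert (D : forall c, is_derive (fun u => u ^ S k / c) u (INR (S k) * u ^ k / c)).
  { intros c; auto_derive; auto.
    change (match k with O => 1 | S _ => INR k + 1 end) with (INR (S k)).
    unfold Rdiv; ring. }
  unfold powfact at 2; replace (u ^ k / INR (fact k)) with (INR (S k) * u ^ k / INR (fact (S k))); [apply D|].
  rewrite fact_simpl, mult_INR.
  pose proof (INR_fact_lt_0 k); pose proof (INR_S_pos k); field; split; lra.
Qed.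

Lemma exp_powfact_series u t : is_series (fun k => powfact k u * t ^ k) (exp (u * t)).
Proof.
  pose proof (is_exp_Reals (u * t)) as H; apply is_pseries_R in H.
  apply (series_eq _ _ _ _ H); auto.
  intros n; unfold powfact; rewrite Rpow_mult_distr; unfold Rdiv; ring.
Qed.

(** One term of the nonnegative series for [exp (u d)] is at most its sum. *)
Lemma powfact_le k u d : 0 < d -> 0 <= u -> powfact k u <= exp (u * d) * (/ d) ^ k.
Proof.
  intros Hd Hu. pose proof (exp_powfact_series u d) as H.
  assert (P : forall i, 0 <= powfact i u * d ^ i).
  { intros i; apply Rmult_le_pos; [now apply powfact_nonneg|apply pow_le; lra]. }
  pose proof (term_le_series _ _ k P H) as T; simpl in T.
  assert (0 < d ^ k) by now apply pow_lt.
  rewrite pow_inv. apply Rmult_le_reg_r with (d ^ k); auto.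
  rewrite Rmult_assoc, Rinv_l by lra; lra.
Qed.

(** The analogue of Cauchy's estimate at radius [d]: [exp (- (u * (x - d)))] is the largest value of
    the exponential on [[x - d, x + d]]. *)
Lemma exp_coef_bound k u x d : 0 < d -> 0 <= u ->
  0 <= exp (- (u * x)) * powfact k u <= exp (- (u * (x - d))) * (/ d) ^ k.
Proof.
  intros Hd Hu; pose proof (exp_pos (- (u * x))); split.
  - apply Rmult_le_pos; [lra|now apply powfact_nonneg].
  - replace (- (u * (x - d))) with (- (u * x) + u * d) by ring.
    rewrite exp_plus, Rmult_assoc. apply Rmult_le_compat_l; [lra|now apply powfact_le].
Qed.

Lemma exp_coef_series u x t :
  is_series (fun k => exp (- (u * x)) * powfact k u * t ^ k) (exp (- (u * (x - t)))).
Proof.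
  replace (- (u * (x - t))) with (- (u * x) + u * t) by ring; rewrite exp_plus.
  apply (series_eq _ _ _ _ (series_scal (exp (- (u * x))) _ _ (exp_powfact_series u t))); auto.
  intros; simpl; ring.
Qed.

Lemma unif_analytic_exp lo hi u : 0 <= u -> unif_analytic lo hi (fun y => exp (- (u * y))).
Proof.
  intros Hu; exists (exp (- (u * (lo - 1)))), 1; repeat split; try lra; [apply exp_pos|].
  intros x Hx; exists (fun k => exp (- (u * x)) * powfact k u); split.
  - intros k; pose proof (exp_coef_bound k u x 1 ltac:(lra) Hu) as [H1 H2].
    rewrite Rabs_pos_eq by auto; eapply Rle_trans; [exact H2|].
    rewrite Rinv_1; apply Rmult_le_compat_r; [rewrite pow1; lra|]. apply exp_le; nra.
  - intros t _; apply exp_coef_series.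
Qed.

(* Taylor coefficients in [t] of [exp (- (a * y)) - exp (- (b * y))] at [y = x - t]. *)
Definition diff_coef (a b x : R) (k : nat) : R :=
  exp (- (a * x)) * powfact k a - exp (- (b * x)) * powfact k b.

Lemma diff_coef_series a b x t :
  is_series (fun k => diff_coef a b x k * t ^ k) (exp (- (a * (x - t))) - exp (- (b * (x - t)))).
Proof.
  apply (series_eq _ _ _ _ (series_minus _ _ _ _ (exp_coef_series a x t) (exp_coef_series b x t))); auto.
  intros; unfold diff_coef; simpl; ring.
Qed.

Lemma mvt_bound (f df : R -> R) a b m : a <= b ->
  (forall x, a <= x <= b -> is_derive f x (df x)) ->
  (forall x, a <= x <= b -> Rabs (df x) <= m) -> Rabs (f a - f b) <= (b - a) * m.
Proof.
  intros Hab D B.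
  destruct (MVT_gen f a b df) as [c [Hc E]].
  - intros x Hx; rewrite Rmin_left, Rmax_right in Hx by auto; apply D; lra.
  - intros x Hx; rewrite Rmin_left, Rmax_right in Hx by auto.
    apply continuity_pt_filterlim, (ex_derive_continuous f); exists (df x); now apply D.
  - rewrite Rmin_left, Rmax_right in Hc by auto.
    replace (f a - f b) with (- (df c * (b - a))) by lra.
    rewrite Rabs_Ropp, Rabs_mult, (Rabs_pos_eq (b - a)), Rmult_comm by lra.
    apply Rmult_le_compat_l; [lra|auto].
Qed.

(** Mean value theorem in the exponent [u] between [a] and [b]. The derivative of
    [exp (- u x) u^k / k!] has two terms under the same estimate, the second weighted by [x], whence
    [1 + x]; [d <= 1] absorbs the shift from [k - 1] to [k]. The factor [b - a] provides summability
    over consecutive integers. *)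
Lemma diff_coef_bound a b x d k : 0 <= a <= b -> 0 < d <= 1 -> d <= x ->
  Rabs (diff_coef a b x k) <= (b - a) * ((1 + x) * exp (- (a * (x - d))) * (/ d) ^ k).
Proof.
  intros Hab Hd Hx.
  set (df := fun u => match k with O => 0 | S j => exp (- (u * x)) * powfact j u end - x * (exp (- (u * x)) * powfact k u)).
  apply (mvt_bound (fun u => exp (- (u * x)) * powfact k u) df); [lra| |].
  - intros u Hu. unfold df.
    assert (D1 : is_derive (fun u => exp (- (u * x))) u (- x * exp (- (u * x)))) by (auto_derive; auto; ring).
    assert (D2 : is_derive (powfact k) u (match k with O => 0 | S j => powfact j u end)).
    { destruct k as [|j]; [|apply powfact_derive].
      unfold powfact; simpl; auto_derive; auto; lra. }
    pose proof (is_derive_mult _ _ u _ _ D1 D2 Rmult_comm) as D3.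
    unfold mult, plus in D3; simpl in D3.
    match type of D3 with is_derive _ _ ?l => replace (match k with O => 0 | S j => _ end - _) with l end;
      [exact D3|].
    destruct k; ring.
  - intros u Hu. unfold df.
    pose proof (exp_coef_bound k u x d ltac:(lra) ltac:(lra)) as [A1 A2].
    assert (Hd1 : 1 <= / d) by (rewrite <- Rinv_1; apply Rinv_le_contravar; lra).
    assert (Hp : 0 <= (/ d) ^ k) by (apply pow_le; lra).
    assert (Z0 : exp (- (u * (x - d))) <= exp (- (a * (x - d)))) by (apply exp_le; nra).
    assert (A3 : exp (- (u * x)) * powfact k u <= exp (- (a * (x - d))) * (/ d) ^ k) by nra.
    assert (A4 : 0 <= match k with O => 0 | S j => exp (- (u * x)) * powfact j u end <=
                 exp (- (a * (x - d))) * (/ d) ^ k).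
    { destruct k as [|j]; [pose proof (exp_pos (- (a * (x - d)))); simpl in *; nra|].
      pose proof (exp_coef_bound j u x d ltac:(lra) ltac:(lra)) as [B1 B2]. split; auto.
      eapply Rle_trans; [exact B2|]. apply Rmult_le_compat; auto; [left; apply exp_pos|apply pow_le; lra|].
      apply Rle_pow; auto. }
    apply Rabs_le. set (e := exp (- (a * (x - d))) * (/ d) ^ k) in *.
    replace ((1 + x) * exp (- (a * (x - d))) * (/ d) ^ k) with (e + x * e) by (unfold e; ring).
    destruct A4. assert (0 <= x * (exp (- (u * x)) * powfact k u) <= x * e) by (split; [apply Rmult_le_pos; lra|apply Rmult_le_compat_l; lra]).
    lra.
Qed.

(** * Convergence of the nonnegative series *)

(** The probability that a Poisson variable of mean [y] is at most [k]; its derivative telescopes to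
    one term of constant sign. *)
Definition exp_partial (k : nat) (y : R) : R := exp (- y) * sum_f_R0 (fun j => powfact j y) k.

Lemma exp_partial_derive k y : is_derive (exp_partial k) y (- (exp (- y) * powfact k y)).
Proof.
  assert (D1 : is_derive (fun u => exp (- u)) y (- exp (- y))) by (auto_derive; auto; ring).
  assert (D2 : is_derive (fun u => sum_f_R0 (fun j => powfact j u) k) y
                 (sum_f_R0 (fun j => powfact j y) k - powfact k y)).
  { induction k as [|k IH].
    - simpl. rewrite Rminus_diag. unfold powfact; simpl; auto_derive; auto; lra.
    - simpl. pose proof (is_derive_plus _ _ _ _ _ IH (powfact_derive k y)) as D.
      unfold plus in D; simpl in D.
      match type of D with is_derive _ _ ?l => replace (_ - _) with l end; [exact D|ring]. }
  pose proof (is_derive_mult _ _ y _ _ D1 D2 Rmult_comm) as D3.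
  unfold mult, plus in D3; simpl in D3.
  match type of D3 with is_derive _ _ ?l => replace (- _) with l end; [exact D3|ring].
Qed.

Lemma exp_partial_decr k a b : 0 <= a <= b -> exp_partial k b <= exp_partial k a.
Proof.
  intros H.
  destruct (MVT_gen (exp_partial k) a b (fun y => - (exp (- y) * powfact k y))) as [c [Hc E]].
  - intros; apply exp_partial_derive.
  - intros x _; apply continuity_pt_filterlim, (ex_derive_continuous (exp_partial k)); eexists; apply exp_partial_derive.
  - rewrite Rmin_left, Rmax_right in Hc by lra.
    pose proof (powfact_nonneg k c ltac:(lra)); pose proof (exp_pos (- c)).
    assert (0 <= exp (- c) * powfact k c) by (apply Rmult_le_pos; lra). nra.
Qed.

(* Taylor coefficients in [t] of [(exp (- (a * y)) - exp (- (b * y))) / y] at [y = x - t]. *)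
Definition mean_coef (a b x : R) (k : nat) : R :=
  cauchy (diff_coef a b x) (fun j => / x * (/ x) ^ j) k.

(* The coefficient is a positive multiple of a difference of values of [exp_partial k]. *)
Lemma mean_coef_nonneg a b x k : 0 <= a <= b -> 0 < x -> 0 <= mean_coef a b x k.
Proof.
  intros Hab Hx.
  (* Multiplying the coefficient of index [j] by [x ^ j] turns [a ^ j] into [(a x)^j], so the Cauchy
     product with the series of [1 / (x - t)] is a difference of truncated exponential series. *)
  assert (E : mean_coef a b x k = / x * (/ x) ^ k * (exp_partial k (a * x) - exp_partial k (b * x))).
  { unfold mean_coef, cauchy, exp_partial.
    replace (exp (- (a * x)) * sum_f_R0 (fun j => powfact j (a * x)) k -
             exp (- (b * x)) * sum_f_R0 (fun j => powfact j (b * x)) k) with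
      (sum_f_R0 (fun j => diff_coef a b x j * x ^ j) k).
    - rewrite scal_sum; apply sum_eq; intros i Hi.
      replace ((/ x) ^ k) with ((/ x) ^ i * (/ x) ^ (k - i)) by (rewrite <- pow_add; f_equal; lia).
      rewrite (pow_inv x i). field. split; apply Rgt_not_eq; [apply pow_lt|]; lra.
    - rewrite !scal_sum, <- minus_sum; apply sum_eq; intros i Hi.
      unfold diff_coef, powfact; rewrite !Rpow_mult_distr; field; apply INR_fact_neq_0. }
  rewrite E; apply Rmult_le_pos.
  - assert (0 < / x) by now apply Rinv_0_lt_compat. apply Rmult_le_pos; [lra|apply pow_le; lra].
  - assert (exp_partial k (b * x) <= exp_partial k (a * x)); [|lra].
    apply exp_partial_decr; nra.
Qed.

Lemma mean_coef_series a b x t : 0 <= a <= b -> 0 < x -> Rabs t < x ->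
  is_series (fun k => mean_coef a b x k * t ^ k)
    ((exp (- (a * (x - t))) - exp (- (b * (x - t)))) / (x - t)).
Proof.
  intros Hab Hx Ht; pose proof (Rabs_pos t) as P.
  assert (Hx' : 0 < / x) by now apply Rinv_0_lt_compat.
  assert (q1 : Rabs t * / x < 1).
  { apply Rmult_lt_reg_r with x; auto. rewrite Rmult_assoc, Rinv_l; lra. }
  apply cauchy_series.
  - apply diff_coef_series.
  - apply (series_eq (fun k => / x * (t * / x) ^ k) _ (/ x * / (1 - t * / x))).
    + apply series_scal, is_series_geom. rewrite Rabs_mult, (Rabs_pos_eq (/ x)); lra.
    + intros n; rewrite Rpow_mult_distr; ring.
    + pose proof (Rle_abs t). field. split; lra.
  - set (d := (Rabs t + x) / 2).
    apply (coef_abs_series _ (exp (- (a * (x - d))) + exp (- (b * (x - d)))) (/ d)).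
    + apply Rinv_0_lt_compat; unfold d; lra.
    + apply Rmult_lt_reg_r with d; [unfold d; lra|]. rewrite Rmult_assoc, Rinv_l; unfold d; lra.
    + intros k; unfold diff_coef.
      pose proof (exp_coef_bound k a x d ltac:(unfold d; lra) ltac:(lra)).
      pose proof (exp_coef_bound k b x d ltac:(unfold d; lra) ltac:(lra)).
      apply Rabs_le; lra.
  - apply (coef_abs_series _ (/ x) (/ x)); auto.
    intros k; rewrite Rabs_pos_eq; [lra|]. apply Rmult_le_pos; [lra|apply pow_le; lra].
Qed.

(** * The alternating zeta function *)

(** The indicator selects pairs that start at an odd integer [n + 1]; indexing by all [n] lets the
    estimates for consecutive logarithms apply directly. *)
Definition eta_term (n : nat) (y : R) : R :=
  (if dvd 2 (S n) then 0 else 1) * (exp (- (lnS n * y)) - exp (- (lnS (S n) * y))).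

(* The series [sum_(n >= 1) (-1)^(n-1) n^(-y)], with consecutive terms grouped in pairs. *)
Definition eta (y : R) : R := Series (fun n => eta_term n y).

Lemma eta_analytic lo hi : / 2 <= lo ->
  unif_analytic lo hi eta /\ forall x, lo <= x <= hi -> ex_series (fun n => eta_term n x).
Proof.
  intros Hlo.
  apply (unif_analytic_series lo hi eta_term
    (fun n x k => (if dvd 2 (S n) then 0 else 1) * diff_coef (lnS n) (lnS (S n)) x k)
    (* Radius [d = 1/4]: for [x >= 1/2] the exponent [x - d] is at least [1/4], and
       [ex_series_lnS_step] sums the majorant. *)
    (fun n => (1 + Rabs hi) * ((lnS (S n) - lnS n) * exp (- (lnS n * / 4)))) (/ / 4)).
  - lra.
  - destruct (ex_series_lnS_step (/ 4) ltac:(lra)) as [l Hl].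
    exists ((1 + Rabs hi) * l); now apply series_scal.
  - intros n x k Hx.
    pose proof (lnS_nonneg n); pose proof (lnS_step_pos n); pose proof (Rle_abs hi).
    pose proof (diff_coef_bound (lnS n) (lnS (S n)) x (/ 4) k ltac:(lra) ltac:(lra) ltac:(lra)) as B.
    assert (P4 : 0 < (/ / 4) ^ k) by (apply pow_lt; lra).
    assert (E : exp (- (lnS n * (x - / 4))) <= exp (- (lnS n * / 4))) by (apply exp_le; nra).
    pose proof (exp_pos (- (lnS n * (x - / 4)))).
    rewrite Rabs_mult. apply Rle_trans with (1 * Rabs (diff_coef (lnS n) (lnS (S n)) x k)).
    { apply Rmult_le_compat_r; [apply Rabs_pos|]. destruct (dvd 2 (S n)); [rewrite Rabs_R0|rewrite Rabs_R1]; lra. }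
    rewrite Rmult_1_l; eapply Rle_trans; [exact B|].
    replace ((1 + Rabs hi) * ((lnS (S n) - lnS n) * exp (- (lnS n * / 4))) * (/ / 4) ^ k) with
      ((lnS (S n) - lnS n) * ((1 + Rabs hi) * exp (- (lnS n * / 4)) * (/ / 4) ^ k)) by ring.
    apply Rmult_le_compat_l; [lra|]. apply Rmult_le_compat_r; [lra|].
    apply Rmult_le_compat; lra.
  - intros n x t Hx Ht; unfold eta_term.
    apply (series_eq _ _ _ _ (series_scal (if dvd 2 (S n) then 0 else 1) _ _ (diff_coef_series (lnS n) (lnS (S n)) x t))); auto.
    intros; simpl; ring.
Qed.

(** The first pair [1 - 2^(-y)] gives the bound, all pairs being nonnegative; [lnS 1] is [log 2]. *)
Lemma eta_lower y : / 2 <= y -> 1 - exp (- (lnS 1 * / 2)) <= eta y.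
Proof.
  intros Hy. destruct (eta_analytic y y Hy) as [_ H]. 
  apply Rle_trans with (eta_term 0 y).
  - unfold eta_term; simpl dvd; rewrite lnS_0, Rmult_0_l, Ropp_0, exp_0.
    change (dvd 2 1) with false; cbv iota.
    assert (exp (- (lnS 1 * y)) <= exp (- (lnS 1 * / 2))); [|lra].
    apply exp_le; pose proof (lnS_nonneg 1); nra.
  - apply (term_le_series (fun n => eta_term n y)); [|apply Series_correct, H; lra].
    intros i; unfold eta_term; apply Rmult_le_pos; [destruct (dvd 2 (S i)); lra|].
    assert (exp (- (lnS (S i) * y)) <= exp (- (lnS i * y))); [|lra].
    apply exp_le; pose proof (lnS_step_pos i); nra.
Qed.

Lemma dvd_2_S n : dvd 2 (S n) = negb (dvd 2 n).
Proof.
  unfold dvd. destruct (Nat.Even_or_Odd n) as [[k ->]|[k ->]].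
  - replace (S (2 * k)) with (1 + k * 2)%nat by lia; rewrite Nat.Div0.mod_add.
    rewrite Nat.mul_comm, Nat.Div0.mod_mul; reflexivity.
  - replace (S (2 * k + 1)) with (S k * 2)%nat by lia; rewrite Nat.Div0.mod_mul.
    replace (2 * k + 1)%nat with (1 + k * 2)%nat by lia; rewrite Nat.Div0.mod_add; reflexivity.
Qed.

(** The even integers are subtracted twice from [Z], once because they start no pair and once as
    second members of pairs; each time they contribute [2^(-y) Z]. *)
Lemma eta_zeta y (Z : R) : is_series (fun n => exp (- (lnS n * y))) Z ->
  is_series (fun n => eta_term n y) ((1 - 2 * exp (- (lnS 1 * y))) * Z).
Proof.
  intros HZ.
  assert (HE : is_series (fun n => if dvd 2 (S n) then exp (- (lnS n * y)) else 0) (exp (- (lnS 1 * y)) * Z)).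
  { apply (series_multiples (fun k => exp (- (lnS 1 * y)) * exp (- (lnS k * y))) _ 2); [lia| | |now apply series_scal].
    - intros k; rewrite (proj2 (dvdP _ _)) by (exists (S k); lia).
      rewrite (lnS_mul_sub1 1 k), <- exp_plus; f_equal; ring.
    - intros n D; now rewrite dvd_false. }
  assert (HE' : is_series (fun n => if dvd 2 (S (S n)) then exp (- (lnS (S n) * y)) else 0) (exp (- (lnS 1 * y)) * Z)).
  { apply (is_series_incr_1 (fun n => if dvd 2 (S n) then exp (- (lnS n * y)) else 0)).
    apply (series_eq _ _ _ _ HE); auto. change (dvd 2 1) with false; cbv iota.
    unfold plus; simpl; rring. }
  apply (series_eq _ _ _ _ (series_minus _ _ _ _ (series_minus _ _ _ _ HZ HE) HE')); [|ring].
  intros n; unfold eta_term; rewrite (dvd_2_S (S n)); destruct (dvd 2 (S n)); simpl negb; cbv iota; ring.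
Qed.

(** The terms of [zeta(2 s)] at [s = 1/2 + w]. *)
Definition zeta2_term (n : nat) (w : R) : R := exp (- (lnS n * (1 + 2 * w))).

Lemma zeta2_analytic lo hi : 0 < lo -> unif_analytic lo hi (fun w => Series (fun n => zeta2_term n w)).
Proof.
  intros Hlo.
  apply (unif_analytic_series lo hi zeta2_term
    (fun n x k => exp (- lnS n) * (exp (- (2 * lnS n * x)) * powfact k (2 * lnS n)))
    (* Radius [lo / 2], because the exponent is [2 log (n+1)]: from [2 (x - lo / 2) >= lo] comes the
       majorant [(n+1)^(-1-lo)]. *)
    (fun n => exp (- (lnS n * (1 + lo)))) (/ (lo / 2))).
  - apply Rinv_0_lt_compat; lra.
  - apply zeta_summable; lra.
  - intros n x k Hx. pose proof (lnS_nonneg n).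
    pose proof (exp_coef_bound k (2 * lnS n) x (lo / 2) ltac:(lra) ltac:(lra)) as [B1 B2].
    rewrite Rabs_mult, (Rabs_pos_eq (exp _)), (Rabs_pos_eq (_ * _)) by (auto; left; apply exp_pos).
    replace (- (lnS n * (1 + lo))) with (- lnS n + - (lnS n * lo)) by ring.
    rewrite exp_plus, (Rmult_assoc (exp (- lnS n)) (exp (- (lnS n * lo)))).
    apply Rmult_le_compat_l; [left; apply exp_pos|].
    eapply Rle_trans; [exact B2|]. apply Rmult_le_compat_r.
    + apply pow_le; left; apply Rinv_0_lt_compat; lra.
    + apply exp_le; nra.
  - intros n x t Hx Ht; unfold zeta2_term.
    replace (- (lnS n * (1 + 2 * (x - t)))) with (- lnS n + - (2 * lnS n * (x - t))) by ring.
    rewrite exp_plus.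
    apply (series_eq _ _ _ _ (series_scal (exp (- lnS n)) _ _ (exp_coef_series (2 * lnS n) x t))); auto.
    intros; simpl; ring.
Qed.

Lemma cpow_neg_real n y : cpow_neg (S n) (RtoC y) = RtoC (exp (- (lnS n * y))).
Proof.
  unfold cpow_neg, RtoC, lnS, Re, Im; simpl fst; simpl snd.
  rewrite Rmult_0_r, cos_0, sin_0; f_equal; [rewrite Rmult_1_r; f_equal; ring|ring].
Qed.

Lemma cseries_real x l : is_series x l -> cseries (fun n => RtoC (x n)) (RtoC l).
Proof.
  intros H; split; simpl; auto.
  apply (series_eq (fun _ => 0) _ (sum_n (fun _ => 0) 0)); [apply series_finite; auto|auto|].
  rewrite sum_O; reflexivity.
Qed.

Section Convergence.
Variables (lam : nat -> R) (B : R).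
Hypothesis HL : is_liouville lam.
Hypothesis HB : forall N, sum_n (t_half lam) N <= B.

Let gap (n : nat) : R := B - sum_n (t_half lam) n.

(** Landau's theorem with [Q w = w eta(w + 1/2)], from the interval [[1, 2]] down to [u]. On
    [[1, 2]], where [s = w + 1/2 > 1], Abel summation together with [zeta(2 s) = D zeta(s)] and
    [eta(s) = (1 - 2^(1-s)) zeta(s)] gives [Q f = Kf]. *)
Lemma gap_mean_convergent u : 0 < u <= / 2 -> exists l,
  is_series (fun n => gap n * ((exp (- (lnS n * u)) - exp (- (lnS (S n) * u))) / u)) l.
Proof.
  intros Hu.
  assert (Pg : forall n, 0 <= gap n) by (intros n; unfold gap; specialize (HB n); lra).
  assert (Pl : forall n, 0 <= lnS n <= lnS (S n)).
  { intros n; pose proof (lnS_nonneg n); pose proof (lnS_step_pos n); lra. }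
  set (Kf := fun w => B * eta (w + / 2) -
     (1 - 2 * exp (- (lnS 1 * (w + / 2)))) * Series (fun n => zeta2_term n w)).
  (* The lower bound for [eta] from its first pair; hence [Q] is at least [u * q0] on [[u, 2]]. *)
  set (q0 := 1 - exp (- (lnS 1 * / 2))).
  assert (Hq0 : 0 < q0).
  { unfold q0. assert (exp (- (lnS 1 * / 2)) < exp 0); [|rewrite exp_0 in *; lra].
    apply exp_increasing. pose proof (lnS_step_pos 0); rewrite lnS_0 in *; lra. }
  destruct (landau (fun n w => gap n * ((exp (- (lnS n * w)) - exp (- (lnS (S n) * w))) / w))
    (fun n x k => gap n * mean_coef (lnS n) (lnS (S n)) x k)
    (fun w => w * eta (w + / 2)) Kf u 1 2 (u * q0)) as [l Hl]; [..|now exists l]; try lra.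
  - intros n x k Hx; apply Rmult_le_pos; auto. apply mean_coef_nonneg; auto.
  - intros n x t Hx Ht.
    apply (series_eq _ _ _ _ (series_scal (gap n) _ _ (mean_coef_series _ _ x t (Pl n) Hx Ht))); auto.
    intros; simpl; ring.
  - apply unif_analytic_mult; [apply unif_analytic_id|].
    apply (unif_analytic_shift u 2 (/ 2)), eta_analytic; lra.
  - unfold Kf; apply unif_analytic_minus; apply unif_analytic_mult.
    + apply unif_analytic_const.
    + apply (unif_analytic_shift u 2 (/ 2)), eta_analytic; lra.
    + apply unif_analytic_minus; [apply unif_analytic_const|].
      apply unif_analytic_mult; [apply unif_analytic_const|].
      apply (unif_analytic_shift u 2 (/ 2) (fun y => exp (- (lnS 1 * y)))).
      apply unif_analytic_exp, lnS_nonneg.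
    + apply zeta2_analytic; lra.
  - nra.
  - intros x Hx. pose proof (eta_lower (x + / 2) ltac:(lra)) as H; fold q0 in H. nra.
  - intros w Hw.
    assert (Hs : 1 < Re (RtoC (w + / 2))) by (simpl; lra).
    destruct (zeta_summable (w + / 2) ltac:(lra)) as [Z HZ].
    destruct (liouville_series_ex lam HL _ Hs) as [D HD].
    assert (HZ' : cseries (fun n => cpow_neg (S n) (RtoC (w + / 2))) (RtoC Z)).
    { apply (cseries_eq _ _ _ _ (cseries_real _ _ HZ)); auto. intros n; now rewrite cpow_neg_real. }
    pose proof (liouville_zeta lam HL _ _ _ Hs HZ' HD) as [H2 _].
    assert (HD' : cseries (fun n => (RtoC (lam (S n)) * cpow_neg (S n) (RtoC w + RtoC (/ 2)))%C) D).
    { rewrite <- RtoC_plus; exact HD. }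
    destruct (liouville_abel lam B (RtoC w) D HL ltac:(simpl; lra) HD') as [H3 _].
    exists ((B - fst D) / w); split.
    + apply (series_eq _ _ _ _ (series_scal (/ w) _ _ H3)).
      * intros n; rewrite !cpow_neg_real; unfold gap, Cmult, Cminus, Cplus, Copp, RtoC; simpl fst; simpl snd.
        unfold Rdiv; ring.
      * simpl; unfold Rdiv; ring.
    + assert (E1 : eta (w + / 2) = (1 - 2 * exp (- (lnS 1 * (w + / 2)))) * Z).
      { unfold eta; apply is_series_unique, eta_zeta, HZ. }
      assert (E2 : Series (fun n => zeta2_term n w) = fst D * Z).
      { apply is_series_unique, (series_eq _ _ _ _ H2).
        - intros n; rewrite <- RtoC_mult, cpow_neg_real; unfold zeta2_term; simpl; f_equal; field.
        - simpl; ring. }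
      unfold Kf; rewrite E1, E2; field; lra.
Qed.

(** This form dominates complex differences by the mean value theorem. Passing to the smaller [v]
    enlarges the terms and meets the condition [v <= 1/2]; [exp v] again moves the exponential
    across a step of length at most [1]. *)
Lemma gap_summable u : 0 < u ->
  ex_series (fun n => gap n * ((lnS (S n) - lnS n) * exp (- (lnS n * u)))).
Proof.
  intros Hu. set (v := Rmin u (/ 2)).
  assert (Hv : 0 < v <= / 2) by (split; [apply Rmin_glb_lt; lra|apply Rmin_r]).
  assert (Hvu : v <= u) by apply Rmin_l.
  destruct (gap_mean_convergent v Hv) as [l Hl].
  apply (ex_series_dom _ (fun n => exp v * (gap n * ((exp (- (lnS n * v)) - exp (- (lnS (S n) * v))) / v)))).
  2:{ exists (exp v * l); now apply series_scal. }
  intros n.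
  assert (Pg : 0 <= gap n) by (unfold gap; specialize (HB n); lra).
  pose proof (lnS_nonneg n) as P0; pose proof (lnS_step_pos n) as P1; pose proof (lnS_step_le1 n) as P2.
  pose proof (exp_pos (- (lnS n * u))) as P3.
  rewrite Rabs_pos_eq by (apply Rmult_le_pos; [auto|apply Rmult_le_pos; lra]).
  replace (exp v * (gap n * ((exp (- (lnS n * v)) - exp (- (lnS (S n) * v))) / v))) with
    (gap n * (exp v * ((exp (- (lnS n * v)) - exp (- (lnS (S n) * v))) / v))) by ring.
  apply Rmult_le_compat_l; auto.
  pose proof (exp_diff_lower (lnS n) (lnS (S n)) v) as H.
  apply Rle_trans with (exp v * ((lnS (S n) - lnS n) * exp (- (lnS (S n) * v)))).
  - replace (exp v * ((lnS (S n) - lnS n) * exp (- (lnS (S n) * v)))) with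
      ((lnS (S n) - lnS n) * (exp v * exp (- (lnS (S n) * v)))) by ring.
    apply Rmult_le_compat_l; [lra|]. rewrite <- exp_plus; apply exp_le; nra.
  - apply Rmult_le_compat_l; [left; apply exp_pos|].
    apply Rmult_le_reg_l with v; [lra|].
    replace (v * ((exp (- (lnS n * v)) - exp (- (lnS (S n) * v))) / v)) with
      (exp (- (lnS n * v)) - exp (- (lnS (S n) * v))) by (field; lra).
    lra.
Qed.
End Convergence.

(** * Holomorphic continuation *)

(** Differentiation in a real variable, by components, so that the real mean value theorem applies
    to each. *)
Definition cderive (f : R -> C) (x : R) (l : C) : Prop :=
  is_derive (fun t => fst (f t)) x (fst l) /\ is_derive (fun t => snd (f t)) x (snd l).

Lemma cderive_eq f x l l' : cderive f x l -> l = l' -> cderive f x l'.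
Proof. now intros H <-. Qed.

Lemma is_derive_value (f : R -> R) x (l l' : R) : is_derive f x l -> l = l' -> is_derive f x l'.
Proof. now intros H <-. Qed.

Lemma cderive_minus f g x l m :
  cderive f x l -> cderive g x m -> cderive (fun t => (f t - g t)%C) x (l - m)%C.
Proof. intros [H1 H2] [H3 H4]; split; [exact (is_derive_minus _ _ _ _ _ H1 H3)|exact (is_derive_minus _ _ _ _ _ H2 H4)]. Qed.

Lemma cderive_mult f g x l m : cderive f x l -> cderive g x m ->
  cderive (fun t => (f t * g t)%C) x (l * g x + f x * m)%C.
Proof.
  intros [H1 H2] [H3 H4]; split.
  - eapply is_derive_value.
    + exact (is_derive_minus _ _ _ _ _ (is_derive_mult _ _ x _ _ H1 H3 Rmult_comm) (is_derive_mult _ _ x _ _ H2 H4 Rmult_comm)).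
    + unfold minus, plus, mult, opp; simpl; ring.
  - eapply is_derive_value.
    + exact (is_derive_plus _ _ _ _ _ (is_derive_mult _ _ x _ _ H1 H4 Rmult_comm) (is_derive_mult _ _ x _ _ H2 H3 Rmult_comm)).
    + unfold minus, plus, mult, opp; simpl; ring.
Qed.

Lemma cderive_const c x : cderive (fun _ => c) x 0.
Proof. split; exact (is_derive_const _ x). Qed.

Lemma cderive_RtoC x : cderive RtoC x 1.
Proof. split; [exact (is_derive_id x)|exact (is_derive_const _ x)]. Qed.

Lemma cderive_linear z x : cderive (fun t => RtoC t * z)%C x z.
Proof.
  eapply cderive_eq; [exact (cderive_mult _ _ _ _ _ (cderive_RtoC x) (cderive_const z x))|cbv beta; ring].
Qed.

Lemma cderive_cexp z x : cderive (fun t => cexp (RtoC t * z)) x (z * cexp (RtoC x * z))%C.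
Proof.
  destruct z as [a b]; split; unfold cexp, Cmult, RtoC, Re, Im; simpl; auto_derive; auto; unfold Rminus; ring.
Qed.

(** The factor [2] comes from bounding the real and imaginary parts separately. *)
Lemma cderive_mvt f df a b m : a <= b ->
  (forall t, a <= t <= b -> cderive f t (df t)) ->
  (forall t, a <= t <= b -> Cmod (df t) <= m) -> Cmod (f a - f b)%C <= 2 * ((b - a) * m).
Proof.
  intros Hab D Bd. eapply Rle_trans; [apply Cmod_le_abs|].
  pose proof (mvt_bound (fun t => fst (f t)) (fun t => fst (df t)) a b m Hab (fun t Ht => proj1 (D t Ht))
    (fun t Ht => Rle_trans _ _ _ (Re_le_Cmod_abs _) (Bd t Ht))).
  pose proof (mvt_bound (fun t => snd (f t)) (fun t => snd (df t)) a b m Hab (fun t Ht => proj2 (D t Ht))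
    (fun t Ht => Rle_trans _ _ _ (Im_le_Cmod_abs _) (Bd t Ht))).
  unfold Cminus, Cplus, Copp; simpl; unfold Rminus in *; lra.
Qed.

Lemma Cmod_cexp_le z : Cmod (cexp z) <= exp (Cmod z).
Proof.
  rewrite Cmod_cexp; apply exp_le. eapply Rle_trans; [apply Rle_abs|apply Re_le_Cmod_abs].
Qed.

Lemma Cmod_RtoC_mult t z : 0 <= t -> Cmod (RtoC t * z)%C = t * Cmod z.
Proof. intros H; now rewrite Cmod_mult, Cmod_R, Rabs_pos_eq. Qed.

Lemma cexp_sub1_le z : Cmod (cexp z - 1)%C <= 2 * (Cmod z * exp (Cmod z)).
Proof.
  pose proof (cderive_mvt (fun t => cexp (RtoC t * z)) (fun t => z * cexp (RtoC t * z))%C 0 1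
    (Cmod z * exp (Cmod z)) ltac:(lra) (fun t _ => cderive_cexp z t)) as H.
  cbv beta in H; rewrite Cmult_0_l, Cmult_1_l, cexp_0 in H.
  replace (cexp z - 1)%C with (- (1 - cexp z))%C by ring; rewrite Cmod_opp.
  eapply Rle_trans; [apply H|lra].
  intros t Ht; rewrite Cmod_mult; apply Rmult_le_compat_l; [apply Cmod_ge_0|].
  eapply Rle_trans; [apply Cmod_cexp_le|]. apply exp_le.
  rewrite Cmod_RtoC_mult by lra. pose proof (Cmod_ge_0 z); nra.
Qed.

(** The mean value theorem on [0 <= t <= 1] for [exp (t z) - t z], whose derivative
    [z (exp (t z) - 1)] is controlled by [cexp_sub1_le]. *)
Lemma cexp_sub2_le z : Cmod (cexp z - 1 - z)%C <= 4 * (Cmod z ^ 2 * exp (Cmod z)).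
Proof.
  pose proof (Cmod_ge_0 z) as P.
  pose proof (cderive_mvt (fun t => cexp (RtoC t * z) - RtoC t * z)%C
    (fun t => z * cexp (RtoC t * z) - z)%C 0 1
    (2 * (Cmod z ^ 2 * exp (Cmod z))) ltac:(lra)
    (fun t _ => cderive_minus _ _ _ _ _ (cderive_cexp z t) (cderive_linear z t))) as H.
  cbv beta in H; rewrite Cmult_0_l, Cmult_1_l, cexp_0 in H.
  replace (cexp z - 1 - z)%C with (- (1 - 0 - (cexp z - z)))%C by ring; rewrite Cmod_opp.
  eapply Rle_trans; [apply H|simpl; lra].
  intros t Ht.
  replace (z * cexp (RtoC t * z) - z)%C with (z * (cexp (RtoC t * z) - 1))%C by ring.
  rewrite Cmod_mult.
  replace (2 * (Cmod z ^ 2 * exp (Cmod z))) with (Cmod z * (2 * (Cmod z * exp (Cmod z)))) by ring.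
  apply Rmult_le_compat_l; auto. eapply Rle_trans; [apply cexp_sub1_le|].
  rewrite Cmod_RtoC_mult by lra.
  apply Rmult_le_compat_l; [lra|]. apply Rmult_le_compat; try nra; [left; apply exp_pos|].
  apply exp_le; nra.
Qed.

Lemma Cplus_minus_cancel (s y : C) : (s + (y - s))%C = y.
Proof. ring. Qed.

Lemma is_derive_of_quadratic (F : C -> C) (s l : C) K d : 0 < d -> 0 < K ->
  (forall z, Cmod z < d -> Cmod (F (s + z) - F s - z * l)%C <= K * Cmod z ^ 2) ->
  @is_derive C_AbsRing C_NormedModule F s l.
Proof.
  intros Hd HK H; split; [apply is_linear_scal_l|].
  intros x Hx.
  pose proof (is_filter_lim_locally_unique (K := C_AbsRing) (V := AbsRing_NormedModule C_AbsRing) s x Hx) as E.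
  rewrite <- E; clear x Hx E.
  intros eps.
  assert (Hm : 0 < Rmin d (eps / K)).
  { apply Rmin_glb_lt; auto. apply Rdiv_lt_0_compat; auto; apply cond_pos. }
  exists (mkposreal _ Hm); intros y Hy.
  change (Cmod (y - s)%C < Rmin d (eps / K)) in Hy.
  change (Cmod (F y - F s - (y - s) * l)%C <= eps * Cmod (y - s)%C).
  pose proof (Rmin_l d (eps / K)); pose proof (Rmin_r d (eps / K)).
  specialize (H (y - s)%C ltac:(lra)).
  replace (F (s + (y - s))%C) with (F y) in H.
  2:{ f_equal; symmetry; exact (Cplus_minus_cancel s y). }
  eapply Rle_trans; [exact H|].
  simpl; rewrite Rmult_1_r, <- Rmult_assoc; apply Rmult_le_compat_r; [apply Cmod_ge_0|].
  apply Rle_trans with (K * (eps / K)); [apply Rmult_le_compat_l; lra|].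
  right; field; lra.
Qed.

Definition cSeries (x : nat -> C) : C := (Series (fun n => fst (x n)), Series (fun n => snd (x n))).

Lemma cSeries_correct x l : cseries x l -> cSeries x = l.
Proof.
  destruct l; intros [H1 H2]; unfold cSeries; f_equal; now apply is_series_unique.
Qed.

Lemma t_le_exp u t : 0 < u -> t <= 8 / u * exp (t * (u / 8)).
Proof.
  intros Hu. pose proof (exp_ineq1_le (t * (u / 8))).
  replace t with (8 / u * (t * (u / 8))) at 1 by (field; lra).
  apply Rmult_le_compat_l; [apply Rlt_le, Rdiv_lt_0_compat; lra|lra].
Qed.

Section Holomorphy.
Variables (lam : nat -> R) (B : R).
Hypothesis HL : is_liouville lam.
Hypothesis HB : forall N, sum_n (t_half lam) N <= B.

Let gap (n : nat) : R := B - sum_n (t_half lam) n.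

(** [f] is a function of the logarithm of the integer. Left general, it covers [n^(-w)], its
    derivative in [w] and the Taylor remainder alike. *)
Definition gap_sum (f : R -> C) : C :=
  cSeries (fun n => (RtoC (B - sum_n (t_half lam) n) * (f (lnS n) - f (lnS (S n))))%C).

Lemma gap_cseries v : 0 < v -> exists G, 0 < G /\ forall (f df : R -> C) m,
  (forall t, 0 <= t -> cderive f t (df t)) ->
  (forall t, 0 <= t -> Cmod (df t) <= m * exp (- (t * v))) ->
  cseries (fun n => (RtoC (gap n) * (f (lnS n) - f (lnS (S n))))%C) (gap_sum f) /\
  Cmod (gap_sum f) <= m * G.
Proof.
  intros Hv. destruct (gap_summable lam B HL HB v Hv) as [G HG].
  change (is_series (fun n => gap n * ((lnS (S n) - lnS n) * exp (- (lnS n * v)))) G) in HG.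
  assert (Pg : forall n, 0 <= gap n) by (intros n; unfold gap; specialize (HB n); lra).
  (* One factor [2] is due to the mean value theorem, the other to the modulus of a complex sum; the
     [1] ensures positivity. *)
  exists (4 * G + 1); split.
  { assert (0 <= G); [|lra]. apply (series_nonneg _ _) with (2 := HG).
    intros n; apply Rmult_le_pos; auto. pose proof (lnS_step_pos n).
    apply Rmult_le_pos; [lra|left; apply exp_pos]. }
  intros f df m D Bd.
  assert (Pm : 0 <= m).
  { specialize (Bd 0 ltac:(lra)). rewrite Rmult_0_l, Ropp_0, exp_0 in Bd.
    pose proof (Cmod_ge_0 (df 0)); lra. }
  assert (T : forall n, Cmod (RtoC (gap n) * (f (lnS n) - f (lnS (S n))))%C <=
            2 * m * (gap n * ((lnS (S n) - lnS n) * exp (- (lnS n * v))))).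
  { intros n; rewrite Cmod_RtoC_mult by auto.
    pose proof (lnS_nonneg n); pose proof (lnS_step_pos n).
    pose proof (cderive_mvt f df (lnS n) (lnS (S n)) (m * exp (- (lnS n * v))) ltac:(lra)) as H1.
    replace (2 * m * (gap n * ((lnS (S n) - lnS n) * exp (- (lnS n * v))))) with
      (gap n * (2 * ((lnS (S n) - lnS n) * (m * exp (- (lnS n * v)))))) by ring.
    apply Rmult_le_compat_l; auto. apply H1.
    - intros t Ht; apply D; lra.
    - intros t Ht; eapply Rle_trans; [apply Bd; lra|].
      apply Rmult_le_compat_l; auto. apply exp_le; nra. }
  assert (HG2 := series_scal (2 * m) _ _ HG).
  destruct (cseries_dom _ _ T) as [l Hl]; [now exists (2 * m * G)|].
  assert (E : gap_sum f = l) by (apply cSeries_correct; exact Hl).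
  rewrite E; split; auto.
  eapply Rle_trans; [apply (Cmod_cseries_le _ _ _ _ T Hl HG2)|]. nra.
Qed.

(** For [W = 1/2 - s] the value at [lnS n] is [(n+1)^(1/2 - s)]. *)
Definition cexp_ray (W : C) (t : R) : C := cexp (RtoC t * W).

(** The remainder [exp (t (W + Z)) - exp (t W) - Z t exp (t W)] factors as
    [exp (t W) (exp (t Z) - 1 - t Z)], which is [f2]. Its derivative in [t] is [O(|Z|^2)] times a
    decaying exponential, so [gap_cseries] bounds the summed remainder; [l] is the sum for [f1]. *)
Lemma gap_sum_derive W : Re W < 0 -> exists K d l, 0 < d /\ 0 < K /\
  cseries (fun n => (RtoC (gap n) * (cexp_ray W (lnS n) - cexp_ray W (lnS (S n))))%C)
    (gap_sum (cexp_ray W)) /\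
  forall Z, Cmod Z < d ->
    Cmod (gap_sum (cexp_ray (W + Z)) - gap_sum (cexp_ray W) - Z * l)%C <= K * Cmod Z ^ 2.
Proof.
  intros HW. set (u := - Re W). assert (Hu : 0 < u) by (unfold u; lra).
  destruct (gap_cseries (u / 2) ltac:(lra)) as [G [HG HS]].
  pose proof (Cmod_ge_0 W) as PW.
  assert (P8 : 0 < 8 / u) by (apply Rdiv_lt_0_compat; lra).
  assert (CE : forall t V, Cmod (cexp (RtoC t * V)) = exp (t * Re V)).
  { intros t V; rewrite Cmod_cexp; f_equal; destruct V; simpl; ring. }
  assert (CW : forall t, Cmod (cexp (RtoC t * W)) = exp (- (t * u))).
  { intros t; rewrite CE; f_equal; unfold u; ring. }
  set (m2 := 4 * Cmod W * (8 / u * (8 / u)) + 2 * (8 / u)).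
  assert (Hm2 : 0 < m2).
  { unfold m2. assert (0 < 8 / u * (8 / u)) by now apply Rmult_lt_0_compat. nra. }
  assert (S0 : forall V, Re V <= - (u / 2) ->
    cseries (fun n => (RtoC (gap n) * (cexp_ray V (lnS n) - cexp_ray V (lnS (S n))))%C) (gap_sum (cexp_ray V))).
  { intros V HV. apply (HS (cexp_ray V) (fun t => V * cexp (RtoC t * V))%C (Cmod V)).
    - intros t _; apply cderive_cexp.
    - intros t Ht; rewrite Cmod_mult, CE; apply Rmult_le_compat_l; [apply Cmod_ge_0|].
      apply exp_le; nra. }
  set (f1 := fun t => (RtoC t * cexp (RtoC t * W))%C).
  assert (S1 : cseries (fun n => (RtoC (gap n) * (f1 (lnS n) - f1 (lnS (S n))))%C) (gap_sum f1)).
  { apply (HS f1 (fun t => 1 * cexp (RtoC t * W) + RtoC t * (W * cexp (RtoC t * W)))%C (1 + 8 / u * Cmod W)).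
    - intros t _; apply cderive_mult; [apply cderive_RtoC|apply cderive_cexp].
    - intros t Ht; eapply Rle_trans; [apply Cmod_triangle|].
      rewrite Cmult_1_l, (Cmod_RtoC_mult t), Cmod_mult, CW by auto.
      pose proof (t_le_exp u t Hu) as E8.
      assert (E1 : exp (- (t * u)) <= exp (- (t * (u / 2)))) by (apply exp_le; nra).
      assert (E2 : t * exp (- (t * u)) <= 8 / u * exp (- (t * (u / 2)))).
      { apply Rle_trans with (8 / u * exp (t * (u / 8)) * exp (- (t * u))).
        - apply Rmult_le_compat_r; [left; apply exp_pos|auto].
        - rewrite Rmult_assoc, <- exp_plus; apply Rmult_le_compat_l; [lra|]. apply exp_le; nra. }
      nra. }
  exists (m2 * G), (u / 4), (gap_sum f1); split; [lra|split; [nra|split]].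
  { apply S0; unfold u; lra. }
  intros Z HZ. pose proof (Cmod_ge_0 Z) as PZ.
  set (f2 := fun t => (cexp (RtoC t * W) * (cexp (RtoC t * Z) - (1 - 0) - RtoC t * Z))%C).
  assert (S2 : cseries (fun n => (RtoC (gap n) * (f2 (lnS n) - f2 (lnS (S n))))%C) (gap_sum f2) /\
     Cmod (gap_sum f2) <= m2 * Cmod Z ^ 2 * G).
  { apply (HS f2 (fun t => W * cexp (RtoC t * W) * (cexp (RtoC t * Z) - (1 - 0) - RtoC t * Z) +
                  cexp (RtoC t * W) * (Z * cexp (RtoC t * Z) - 0 - Z))%C).
    - intros t _; unfold f2; apply cderive_mult; [apply cderive_cexp|].
      apply cderive_minus; [|apply cderive_linear].
      apply cderive_minus; [apply cderive_cexp|apply cderive_const].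
    - intros t Ht; eapply Rle_trans; [apply Cmod_triangle|].
      replace (cexp (RtoC t * Z) - (1 - 0) - RtoC t * Z)%C with (cexp (RtoC t * Z) - 1 - RtoC t * Z)%C by ring.
      replace (Z * cexp (RtoC t * Z) - 0 - Z)%C with (Z * (cexp (RtoC t * Z) - 1))%C by ring.
      rewrite !Cmod_mult, CW.
      pose proof (cexp_sub1_le (RtoC t * Z)%C) as A1. pose proof (cexp_sub2_le (RtoC t * Z)%C) as A2.
      rewrite Cmod_RtoC_mult in A1, A2 by auto.
      pose proof (t_le_exp u t Hu) as E8.
      assert (E9 : exp (t * Cmod Z) <= exp (t * (u / 4))) by (apply exp_le; nra).
      set (e := exp (t * (u / 8))) in *.
      assert (He : 1 <= e) by (unfold e; rewrite <- exp_0; apply exp_le; nra).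
      assert (Ee : exp (t * (u / 4)) = e * e) by (unfold e; rewrite <- exp_plus; f_equal; field).
      (* Half of the decay is kept as [E]. The other half is spent: one factor [e * e] on the powers
         of [t], by [t_le_exp], and one on [exp (t |Z|)], by [|Z| < u / 4]. *)
      assert (Eu : exp (- (t * u)) = exp (- (t * (u / 2))) * / (e * e) * / (e * e)).
      { rewrite <- Ee, <- exp_Ropp, <- !exp_plus; f_equal; field. }
      set (E := exp (- (t * (u / 2)))) in *.
      assert (HE : 0 < E) by apply exp_pos.
      assert (Pee : 0 < e * e) by nra.
      assert (T1 : t <= 8 / u * (e * e)) by nra.
      assert (T2 : t * t <= 8 / u * (8 / u) * (e * e)).
      { replace (8 / u * (8 / u) * (e * e)) with ((8 / u * e) * (8 / u * e)) by ring.
        apply Rmult_le_compat; auto. }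
      assert (A1' : Cmod (cexp (RtoC t * Z) - 1)%C <= 2 * Cmod Z * (8 / u) * (e * e) * (e * e)).
      { eapply Rle_trans; [exact A1|].
        replace (2 * Cmod Z * (8 / u) * (e * e) * (e * e)) with (2 * (8 / u * (e * e) * Cmod Z * (e * e))) by ring.
        apply Rmult_le_compat_l; [lra|]. apply Rmult_le_compat; [nra|left; apply exp_pos| |lra].
        apply Rmult_le_compat_r; auto. }
      assert (A2' : Cmod (cexp (RtoC t * Z) - 1 - RtoC t * Z)%C <=
                 4 * Cmod Z ^ 2 * (8 / u * (8 / u)) * (e * e) * (e * e)).
      { eapply Rle_trans; [exact A2|].
        replace (4 * Cmod Z ^ 2 * (8 / u * (8 / u)) * (e * e) * (e * e)) with
          (4 * (8 / u * (8 / u) * (e * e) * Cmod Z ^ 2 * (e * e))) by ring.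
        apply Rmult_le_compat_l; [lra|].
        replace ((t * Cmod Z) ^ 2) with (t * t * Cmod Z ^ 2) by ring.
        apply Rmult_le_compat; [|left; apply exp_pos| |lra].
        - apply Rmult_le_pos; [nra|apply pow2_ge_0].
        - apply Rmult_le_compat_r; [apply pow2_ge_0|auto]. }
      rewrite Eu.
      apply Rle_trans with
        (Cmod W * (E * / (e * e) * / (e * e)) * (4 * Cmod Z ^ 2 * (8 / u * (8 / u)) * (e * e) * (e * e)) +
         E * / (e * e) * / (e * e) * (Cmod Z * (2 * Cmod Z * (8 / u) * (e * e) * (e * e)))).
      + assert (0 < E * / (e * e) * / (e * e)) by (rewrite <- Eu; apply exp_pos).
        apply Rplus_le_compat.
        * apply Rmult_le_compat_l; [apply Rmult_le_pos; lra|auto].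
        * apply Rmult_le_compat_l; [lra|]. apply Rmult_le_compat_l; auto.
      + right; unfold m2; field; split; nra. }
  destruct S2 as [S2 B2].
  replace (gap_sum (cexp_ray (W + Z)) - gap_sum (cexp_ray W) - Z * gap_sum f1)%C with (gap_sum f2).
  { eapply Rle_trans; [exact B2|right; ring]. }
  apply (cseries_unique _ _ _ S2).
  assert (S3 : cseries (fun n => (RtoC (gap n) * (cexp_ray (W + Z) (lnS n) - cexp_ray (W + Z) (lnS (S n))))%C)
                 (gap_sum (cexp_ray (W + Z)))).
  { apply S0. pose proof (Re_le_Cmod_abs Z) as A. pose proof (Rle_abs (fst Z)).
    destruct W, Z; unfold u, Re in *; simpl in *; lra. }
  assert (S4 := S0 W ltac:(unfold u; lra)).
  pose proof (cseries_plus _ _ _ _ S3 (cseries_plus _ _ _ _ (cseries_scal (-1)%C _ _ S4)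
     (cseries_scal (- Z)%C _ _ S1))) as S5.
  apply (cseries_eq _ _ _ _ S5); [|ring].
  intros n; unfold f2, f1, cexp_ray; rewrite !Cmult_plus_distr_l, !cexp_plus; ring.
Qed.

(** The Abel-summed form of the Dirichlet series of [lam], whose sum converges for [Re s > 1/2]. *)
Definition continuation (s : C) : C := (RtoC B - gap_sum (cexp_ray (RtoC (/ 2) - s)))%C.

Lemma continuation_holomorphic : holomorphic_on (fun s => 1 / 2 < Re s) continuation.
Proof.
  intros s Hs.
  destruct (gap_sum_derive (RtoC (/ 2) - s)%C) as [K [d [l [Hd [HK [_ H]]]]]].
  { destruct s; unfold Re in *; simpl in *; lra. }
  exists l; apply (is_derive_of_quadratic _ _ _ K d Hd HK).
  intros z Hz; specialize (H (- z)%C); rewrite Cmod_opp in H; specialize (H Hz).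
  replace (continuation (s + z) - continuation s - z * l)%C with
    (- (gap_sum (cexp_ray (RtoC (/ 2) - s + - z)) - gap_sum (cexp_ray (RtoC (/ 2) - s)) - - z * l))%C.
  - now rewrite Cmod_opp.
  - unfold continuation. replace (RtoC (/ 2) - (s + z))%C with (RtoC (/ 2) - s + - z)%C by ring. ring.
Qed.

Lemma continuation_series s D : 1 < Re s ->
  cseries (fun n => (RtoC (lam (S n)) * cpow_neg (S n) s)%C) D -> continuation s = D.
Proof.
  intros Hs HD.
  assert (HW : Re (RtoC (/ 2) - s)%C < 0) by (destruct s; unfold Re in *; simpl in *; lra).
  destruct (gap_sum_derive _ HW) as [_ [_ [_ [_ [_ [H _]]]]]].
  set (w := (s - RtoC (/ 2))%C).
  assert (Hw : 1 / 2 < Re w) by (unfold w; destruct s; unfold Re in *; simpl in *; lra).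
  assert (HD' : cseries (fun n => (RtoC (lam (S n)) * cpow_neg (S n) (w + RtoC (/ 2)))%C) D).
  { replace (w + RtoC (/ 2))%C with s by (unfold w; ring); auto. }
  pose proof (liouville_abel lam B w D HL Hw HD') as H2.
  unfold continuation. replace (gap_sum (cexp_ray (RtoC (/ 2) - s))) with (RtoC B - D)%C; [ring|].
  apply (cseries_unique _ _ _ H2). apply (cseries_eq _ _ _ _ H); auto.
  intros n; unfold gap, cexp_ray; rewrite !cpow_neg_cexp; do 3 f_equal; unfold w; ring.
Qed.
End Holomorphy.

(** * Non-vanishing of zeta and the conclusion *)

(** At a zero the terms with [n >= 2] would sum to [-1], although their absolute values sum to less
    than [1] when [Re s > 2]. *)
Lemma zeta_nonzero s z : 2 < Re s -> cseries (fun n => cpow_neg (S n) s) z -> z <> 0%C.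
Proof.
  intros Hs [Hz _] E; rewrite E in Hz; simpl in Hz.
  assert (H2 : is_series (fun n => fst (cpow_neg (S (S n)) s)) (-1)).
  { apply (is_series_incr_1 (fun n => fst (cpow_neg (S n) s))).
    apply (series_eq _ _ _ _ Hz); auto.
    rewrite cpow_neg_cexp, lnS_0. replace (- (0 * s))%C with (0 : C) by ring.
    rewrite cexp_0; unfold plus; simpl; rring. }
  (* [n^(-sigma) <= 2^(2 - sigma) n^(-2)] and [sum_(n >= 2) n^(-2) <= 1]. *)
  assert (Tel : forall N, sum_n (fun n => / INR (S (S n)) * / INR (S (S n))) N <= 1).
  { intros N; apply Rle_trans with (sum_n (fun n => / INR (S n) - / INR (S (S n))) N).
    - apply sum_n_le_compat; intros n _.
      pose proof (INR_S_pos n); pose proof (INR_S_pos (S n)).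
      replace (/ INR (S n) - / INR (S (S n))) with (/ INR (S n) * / INR (S (S n))).
      + apply Rmult_le_compat_r; [left; now apply Rinv_0_lt_compat|].
        apply Rinv_le_contravar; auto; rewrite (S_INR (S n)); lra.
      + rewrite (S_INR (S n)) in *; field; lra.
    - rewrite (sum_telescope (fun n => / INR (S n))); simpl INR at 1; rewrite Rinv_1.
      pose proof (Rinv_0_lt_compat _ (INR_S_pos (S N))); lra. }
  destruct (series_bounded (fun n => / INR (S (S n)) * / INR (S (S n))) 1) as [l [Hl Ll]]; auto.
  { intros i; pose proof (Rinv_0_lt_compat _ (INR_S_pos (S i))); nra. }
  set (q := exp (- (lnS 1 * (Re s - 2)))).
  assert (Hq : 0 < q < 1).
  { split; [apply exp_pos|]. rewrite <- exp_0; apply exp_increasing.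
    pose proof (lnS_step_pos 0); rewrite lnS_0 in *; nra. }
  assert (Mono : forall n, lnS 1 <= lnS (S n)).
  { induction n as [|n IH]; [lra|]. pose proof (lnS_step_pos (S n)); lra. }
  assert (A : Rabs (-1) <= q * l).
  { apply (Rabs_series_le _ _ _ _) with (2 := H2) (3 := series_scal q _ _ Hl).
    intros n; eapply Rle_trans; [apply Re_le_Cmod_abs|].
    rewrite Cmod_cpow_neg, <- exp_neg_lnS, <- exp_plus; unfold q; rewrite <- exp_plus; apply exp_le.
    specialize (Mono n); nra. }
  rewrite Rabs_left in A by lra. nra.
Qed.

Theorem theorem3p3 (lam xi : nat -> R) :
  is_liouville lam ->
  (forall n : nat, (2 <= n)%nat ->
     / INR n - Rpower (INR n) (- (1 / 2)) = - (1 / 2) * ln (INR n) * Rpower (INR n) (- xi n)) ->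
  (exists r : R, 0 < r /\ exists X : R, forall x : R, X <= x -> L_x lam xi x <= 1 - r) ->
  (* zeta(2s)/zeta(s), with zeta(s) = sum_{n>=1} n^{-s} on Re s > 1,
     extends holomorphically to Re s > 1/2 *)
  exists F : C -> C,
    holomorphic_on (fun s => 1 / 2 < Re s) F /\
    forall (s z1 z2 : C), 1 < Re s ->
      is_series (fun n : nat => cpow_neg (S n) (2 * s)%C) z1 ->
      is_series (fun n : nat => cpow_neg (S n) s) z2 ->
      F s = (z1 / z2)%C.
Proof.
  intros HL Hxi HLx.
  destruct (t_half_bounded lam xi HL Hxi HLx) as [B HB].
  exists (continuation lam B); split; [now apply continuation_holomorphic|].
  intros s z1 z2 Hs H1 H2.
  apply cseries_iff in H1, H2.
  destruct (liouville_series_ex lam HL s Hs) as [D HD].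
  rewrite (continuation_series lam B HL HB s D Hs HD).
  pose proof (liouville_zeta lam HL s z2 D Hs H2 HD) as HDZ.
  assert (E : z1 = (D * z2)%C) by exact (cseries_unique _ _ _ H1 HDZ).
  (* The real part of [2 s] exceeds [2], so the crude estimate applies there, and
     [zeta(2 s) = D zeta(s)] carries non-vanishing over to [s]. *)
  assert (N1 : z1 <> 0%C).
  { apply (zeta_nonzero (2 * s)%C); auto. destruct s; unfold Re in *; simpl in *; lra. }
  assert (N2 : z2 <> 0%C) by (intros ->; apply N1; rewrite E; ring).
  rewrite E; field; auto.
Qed.
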